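(* Let $V_0:\mathbb{R}\to\mathbb{R}$ be $1$-periodic, with $H_0=-\frac{d^2}{dx^2}+V_0$ having spectral bands $[c_n,d_n]$ and quasimomentum $k(E)$. Suppose $\{E_j\}_{j=1}^\infty\subset\bigcup_n(c_n,d_n)$ is such that the quasimomenta $\{k(E_j)\}_{j\ge1}$ are pairwise different, and suppose that $k(E_i)+k(E_j)\neq\pi$ for any $i,j$ (including $i=j$). Let $h:(0,\infty)\to(0,\infty)$ be any function with $\lim_{x\to\infty}h(x)=\infty$. Then for any given $\{\theta_j\}_{j=1}^\infty\subset[0,\pi]$ there exists a real-valued function $V\in C^\infty[0,\infty)$ such that $$|V(x)|\le\frac{h(x)}{1+x}\quad\text{for all }x>0,$$ and for every $j\geq 1$ the equation $Hu=-u''+(V+V_0)u=E_ju$ on $[0,\infty)$ has a (non-trivial) $L^2(\mathbb{R}^+)$ solution with boundary condition $$\frac{u'(0)}{u(0)}=\tan\theta_j.$$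
   Context: $V_0$ is real-valued and locally integrable, and $\mathbb{R}^+=(0,\infty)$. The spectrum of $H_0$ on $L^2(\mathbb{R})$ is purely absolutely continuous and is a union of closed intervals (spectral bands) $[c_n,d_n]$, any two of which intersect in at most one point. For $E\in(c_n,d_n)$, $H_0\varphi=E\varphi$ has a Floquet solution $\varphi(x,E)=p(x,E)e^{ik(E)x}$ with $p(\cdot,E)$ $1$-periodic and quasimomentum $k(E)\in(0,\pi)$; on each band $k$ is either monotonically increasing from $0$ to $\pi$ or monotonically decreasing from $\pi$ to $0$. (Thus the open intervals $(c_n,d_n)$ are the connected components of the set of real $E$ for which the discriminant, i.e. the trace of the monodromy matrix over one period, has absolute value less than $2$.) The boundary condition $u'(0)/u(0)=\tan\theta_j$ with $\theta_j=\pi/2$ means $u(0)=0$. *)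

(* Defs.v *)
From HB Require Import structures.
From mathcomp Require Import all_boot all_order all_algebra.
From mathcomp Require Import all_classical all_reals all_analysis.
From mathcomp Require Import complex.

Set Implicit Arguments.
Unset Strict Implicit.
Unset Printing Implicit Defensive.

Import Order.TTheory GRing.Theory Num.Theory.
Import numFieldNormedType.Exports.

Local Open Scope classical_set_scope.
Local Open Scope ring_scope.

Section schrodinger.
Context {R : realType}.
Implicit Types (q u v f F k V : R -> R) (E c d theta : R) (I : set R).

(* For an interval I: F is locally absolutely continuous on I and F' = f
   almost everywhere on I. *)
Definition is_primitive I f F :=
  forall a b, I a -> I b -> a <= b ->
    (@lebesgue_measure R).-integrable `[a, b] (EFin \o f) /\
    F b - F a = \int[@lebesgue_measure R]_(t in `[a, b]) f t.

(* u solves - u'' + q u = E u on I in the Caratheodory sense appropriate to a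
   locally integrable q: u and u' are locally absolutely continuous and the
   equation holds almost everywhere. Here v is u'; being continuous on I, it is
   the classical derivative at every point of I (one-sided at an endpoint). *)
Definition schrodinger_pair q E I u v :=
  is_primitive I v u /\ is_primitive I (fun x => (q x - E) * u x) v.

Definition schrodinger_solution q E I u := exists v, schrodinger_pair q E I u v.

(* As q and E are real, this says that phi satisfies the complex equation. *)
Definition schrodinger_csolution q E I (phi : R -> R[i]) :=
  schrodinger_solution q E I (fun x => complex.Re (phi x)) /\
  schrodinger_solution q E I (fun x => complex.Im (phi x)).

(* Row 0 of Phi x holds the values at x of two solutions on the real line,
   row 1 holds their derivatives. *)
Definition fundamental_matrix q E (Phi : R -> 'M[R]_2) :=
  Phi 0 = 1%:M /\
  forall j, schrodinger_pair q E setT (fun x => Phi x 0 j) (fun x => Phi x 1 j).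

Definition monodromy_matrix (V0 : R -> R) E (M : 'M[R]_2) :=
  exists2 Phi, fundamental_matrix V0 E Phi & M = Phi 1.

(* The energies at which the discriminant has absolute value less than 2. *)
Definition stability_set (V0 : R -> R) : set R :=
  [set E | exists2 M, monodromy_matrix V0 E M & `|\tr M| < 2].

Definition spectral_band (V0 : R -> R) c d :=
  exists2 E, stability_set V0 E &
    `]c, d[%classic = connected_component (stability_set V0) E.

Definition open_bands (V0 : R -> R) : set R :=
  \bigcup_(cd in [set cd : R * R | spectral_band V0 cd.1 cd.2])
    `]cd.1, cd.2[%classic.

Definition cexp_i (t : R) : R[i] := Complex (cos t) (sin t).

Definition floquet_solution (V0 : R -> R) E (kappa : R) (phi p : R -> R[i]) :=
  [/\ schrodinger_csolution V0 E setT phi,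
      exists x, phi x != 0,
      forall x, phi x = p x * cexp_i (kappa * x) &
      forall x, p (x + 1) = p x].

(* The values of k outside the open bands are irrelevant. *)
Definition quasimomentum (V0 : R -> R) k :=
  forall E, open_bands V0 E ->
    0 < k E < pi /\ exists phi p, floquet_solution V0 E (k E) phi p.

(* C^oo[0, +oo): V is smooth on (0, +oo), continuous from the right at 0, and
   all its derivatives extend continuously to 0. *)
Definition smooth_half_line V :=
  [/\ forall n x, 0 < x -> derivable (derive1n n V) x 1,
      V x @[x --> 0^'+] --> V 0 &
      forall n, cvg (derive1n n V x @[x --> 0^'+])].

(* u'(0) / u(0) = tan theta for theta in [0, pi], with v = u'; theta = pi / 2
   encodes the Dirichlet condition. *)
Definition boundary_condition theta u v :=
  if theta == pi / 2 then u 0 = 0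
  else u 0 != 0 /\ v 0 / u 0 = tan theta.

Definition square_integrable (D : set R) u :=
  (@lebesgue_measure R).-integrable D (EFin \o (fun x => u x ^+ 2)).

End schrodinger.

(* Main.v *)
Require Import Defs.
From HB Require Import structures.
From mathcomp Require Import all_boot all_order all_algebra.
From mathcomp Require Import all_classical all_reals all_analysis.
From mathcomp Require Import measurable_realfun complex ring lra.

Set Implicit Arguments.
Unset Strict Implicit.
Unset Printing Implicit Defensive.

Import Order.TTheory GRing.Theory Num.Theory.
Import numFieldNormedType.Exports.

Local Open Scope classical_set_scope.
Local Open Scope ring_scope.

(* Let phi_j = a_j + i b_j be the Floquet solution at E_j, with Wronskian
   W_j = a_j b_j' - a_j' b_j. By variation of parameters z1 a_j + z2 b_j solves
   the perturbed equation when
     z1' = - V b_j (z1 a_j + z2 b_j) / W_j,  z2' = V a_j (z1 a_j + z2 b_j) / W_j,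
   and with zeta = z1 + i z2 this gives
     (|zeta|^2)' = (V / W_j) Im((conj(phi_j) zeta)^2).
   Translation by n multiplies phi_j^2 by e^{2 i k_j n}. So V is assembled from
   bumps eta_i(x - n), eta_i being supported in (0, 1) with
   int eta_i phi_i^2 <> 0, whose coefficients oscillate in n with frequency
   2 k_i. On a block of N unit cells on which V has size eps, the bumps eta_j
   lower |zeta_j|^2 by a multiple of eps N |zeta_j|^2, the bumps eta_i, i <> j,
   change it by O(eps) |zeta_j|^2 only, because k_i <> k_j and k_i + k_j <> pi,
   and the second-order effect is O((eps N)^2) |zeta_j|^2. The phases are reset
   from the current states at the start of each block. Treating m energies at
   once with N = N_m large and eps = 8 N_m / x at position x makes
   x^2 |zeta_j|^2 nonincreasing along the blocks for j < m. As h tends to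
   infinity, m can be increased to infinity slowly enough to respect the bound
   on V, and then every u_j = O(1/x). *)

(** * Primitives of integrable functions *)

(** The design looks circular: [V] is built from the states, and the states solve an equation
    containing [V]. Causality breaks the circle. The states at an integer depend only on the
    coefficients of earlier cells, so solutions are defined for every table of coefficients, and the
    table is then filled block by block from their values. The constant 8 is a matter of rates. A
    block multiplies an energy by at most 1 - eps/2 = 1 - 4N/x, half of the first-order gain being
    given up to the second-order error, while x^2 grows by the factor (1 + N/x)^2; the loss wins.
    Decay like 1/x is enough for square integrability. The price is a potential of size C_m / x,
    where C_m depends on the number m of energies treated; this is where h tending to infinity
    enters. Since V_0 is only locally integrable, the equation is handled through integral
    identities, and the product rule is proved for primitives of integrable functions. *)

Section integrable_EFin.
Context d (T : measurableType d) (R : realType).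
Variables (nu : {measure set T -> \bar R}) (D : set T).
Implicit Types f g : T -> R.

Lemma integrableD_EFin f g : measurable D ->
  nu.-integrable D (EFin \o f) -> nu.-integrable D (EFin \o g) ->
  nu.-integrable D (EFin \o (fun x => f x + g x)).
Proof. by move=> mD hf hg; have := integrableD mD hf hg. Qed.

Lemma integrableB_EFin f g : measurable D ->
  nu.-integrable D (EFin \o f) -> nu.-integrable D (EFin \o g) ->
  nu.-integrable D (EFin \o (fun x => f x - g x)).
Proof. by move=> mD hf hg; have := integrableB mD hf hg. Qed.

Lemma integrableZl_EFin k f : measurable D ->
  nu.-integrable D (EFin \o f) ->
  nu.-integrable D (EFin \o (fun x => k * f x)).
Proof. by move=> mD hf; have := integrableZl mD k hf. Qed.

Lemma integrableZr_EFin k f : measurable D ->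
  nu.-integrable D (EFin \o f) ->
  nu.-integrable D (EFin \o (fun x => f x * k)).
Proof. by move=> mD hf; have := integrableZr mD k hf. Qed.

Lemma integrableMl_EFin f g : measurable D -> measurable_fun D g ->
  [bounded g x | x in D] -> nu.-integrable D (EFin \o f) ->
  nu.-integrable D (EFin \o (fun x => f x * g x)).
Proof. by move=> mD mg bg hf; have := integrableMl mD hf mg bg. Qed.

End integrable_EFin.

Section primitives.
Context {R : realType}.
Notation mu := (@lebesgue_measure R).
Implicit Types (f g F G : R -> R) (a b c : R) (I : set R).

Lemma integrable_subitv f a b c d : a <= c -> d <= b ->
  mu.-integrable `[a, b] (EFin \o f) -> mu.-integrable `[c, d] (EFin \o f).
Proof.
move=> ac db; apply: integrableS => //; apply: subset_itv; rewrite bnd_simp//.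
Qed.

Lemma Rint_split f a b c : a <= b -> b <= c ->
  mu.-integrable `[a, c] (EFin \o f) ->
  \int[mu]_(t in `[a, c]) f t =
  \int[mu]_(t in `[a, b]) f t + \int[mu]_(t in `[b, c]) f t.
Proof.
move=> ab bc intf.
have := @Rintegral_itvB R f (BLeft a) (BRight c) b intf.
rewrite !bnd_simp => /(_ ab bc) h.
rewrite -(@Rintegral_itv_obnd_cbnd _ b); first by rewrite -h addrC subrK.
by apply: integrableS intf => //; apply: subset_itvr; rewrite bnd_simp.
Qed.

Lemma continuous_integrable_itv f a b :
  continuous f -> mu.-integrable `[a, b] (EFin \o f).
Proof.
move=> cf; apply: continuous_compact_integrable; first exact: segment_compact.
exact: continuous_subspaceT.
Qed.

Lemma Rint_le_cst f a b M : a <= b ->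
  mu.-integrable `[a, b] (EFin \o f) ->
  (forall x, a <= x <= b -> `|f x| <= M) ->
  `|\int[mu]_(t in `[a, b]) f t| <= M * (b - a).
Proof.
move=> ab intf fM; apply: le_trans (le_normr_Rintegral _ intf) _ => //.
have -> : M * (b - a) = \int[mu]_(t in `[a, b]) M.
  rewrite Rintegral_cst// /= lebesgue_measure_itv/= lte_fin.
  by case: ltgtP ab => // -> _; rewrite subrr.
apply: le_Rintegral => //.
- by move: intf => /integrable_norm.
- by apply: continuous_integrable_itv; exact: cst_continuous.
Qed.

Lemma is_primitiveS I J f F : J `<=` I -> is_primitive I f F ->
  is_primitive J f F.
Proof. by move=> JI h a b Ja Jb; apply: h; exact: JI. Qed.

Lemma eq_is_primitive I f g F G : is_interval I ->
  (forall x, I x -> f x = g x) -> (forall x, I x -> F x = G x) ->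
  is_primitive I f F -> is_primitive I g G.
Proof.
move=> iI fg FG h a b Ia Ib ab; have [i e] := h a b Ia Ib ab.
have fg' : {in `[a, b]%classic, f =1 g}.
  move=> x; rewrite inE/= in_itv/= => xab.
  by apply: fg; apply: iI xab.
split; last by rewrite -!FG// e; exact: eq_Rintegral.
by apply: eq_integrable i => // x xab /=; rewrite fg'.
Qed.

Lemma is_primitiveD I f F g G : is_primitive I f F -> is_primitive I g G ->
  is_primitive I (fun x => f x + g x) (fun x => F x + G x).
Proof.
move=> hf hg a b Ia Ib ab.
have [f1 f2] := hf _ _ Ia Ib ab; have [g1 g2] := hg _ _ Ia Ib ab.
split; last by rewrite RintegralD// -f2 -g2; ring.
exact: integrableD_EFin.
Qed.

Lemma is_primitiveZ I k f F : is_primitive I f F ->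
  is_primitive I (fun x => k * f x) (fun x => k * F x).
Proof.
move=> hf a b Ia Ib ab; have [f1 f2] := hf _ _ Ia Ib ab.
split; last by rewrite RintegralZl// -f2; ring.
exact: integrableZl_EFin.
Qed.

Lemma is_primitive_continuous a b f F : a <= b -> is_primitive `[a, b] f F ->
  {within `[a, b], continuous F}.
Proof.
move=> ab h.
have [aI bI] : `[a, b]%classic a /\ `[a, b]%classic b.
  by rewrite /= !in_itv/= !lexx ab.
have [i _] := h _ _ aI bI ab.
have hc : {within `[a, b], continuous
    (fun x => F a + parameterized_integral mu a x f)}.
  move=> x; apply: cvgD; first exact: cvg_cst.
  exact: (parameterized_integral_continuous ab i).
apply: subspace_eq_continuous hc.
move=> x; rewrite inE/= in_itv/= => /andP[ax xb].
have xI : `[a, b]%classic x by rewrite /= in_itv/= ax.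
have [_ /esym e] := h a x aI xI ax.
by rewrite -[RHS](subrK (F a)) addrC; congr (_ + _); exact: e.
Qed.

Lemma is_primitiveT_continuous f F : is_primitive setT f F -> continuous F.
Proof.
move=> h x.
have /continuous_within_itvP : {within `[x - 1, x + 1], continuous F}.
  apply: (@is_primitive_continuous _ _ f); first by lra.
  exact: is_primitiveS h.
have x1 : x - 1 < x + 1 by lra.
move=> /(_ x1)[hh _ _]; apply: hh.
by rewrite in_itv/=; apply/andP; split; lra.
Qed.

(* The hypothesis at c only concerns intervals containing c; the supremum of
   the points t such that the bound holds on [a, t] is then b. *)
Lemma additive_local_bound (D m : R -> R -> R) a b : a <= b ->
  (forall s t u, a <= s -> s <= t -> t <= u -> u <= b -> D s u = D s t + D t u) ->
  (forall s t u, a <= s -> s <= t -> t <= u -> u <= b -> m s u = m s t + m t u) ->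
  (forall c, a <= c <= b -> exists2 eta, 0 < eta &
    forall s t, a <= s -> s <= c -> c <= t -> t <= b -> t - s < eta ->
    `|D s t| <= m s t) ->
  `|D a b| <= m a b.
Proof.
move=> ab Dadd madd loc.
pose S := [set t | a <= t <= b /\ `|D a t| <= m a t].
have Sa : S a.
  split; first by rewrite lexx.
  have [|eta eta0 h] := loc a; first by rewrite lexx.
  by apply: h; rewrite ?subrr.
have hS : has_sup S.
  by split; [exists a|exists b => t [/andP[]]].
set c := sup S.
have ac : a <= c by exact: ub_le_sup hS.2 _ Sa.
have cb : c <= b by apply: ge_sup; [exists a|move=> t [/andP[]]].
have [|eta eta0 h] := loc c; first by rewrite ac.
have e2 : 0 < eta / 2 by lra.
have [s Ss cs] := sup_adherent e2 hS.
have sc : s <= c by exact: ub_le_sup hS.2 _ Ss.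
have [/andP[as_ sb] Hs] := Ss.
have ext t : c <= t -> t <= b -> t < c + eta / 2 -> S t.
  move=> ct tb te; split; first by rewrite (le_trans ac ct).
  rewrite (Dadd a s t)// ?(le_trans sc ct)//.
  rewrite (madd a s t)// ?(le_trans sc ct)//.
  rewrite (le_trans (ler_normD _ _))// lerD// h//.
  by move: cs; rewrite -/c; lra.
have [bc|bc] := leP b (c + eta / 4).
  by have [] : S b by apply: ext => //; lra.
have /(ub_le_sup hS.2) : S (c + eta / 4) by apply: ext; lra.
by rewrite -/c; lra.
Qed.

(** On a short [s, t] where F and G oscillate by at most d, the increment of FG is exactly the
    integral of f G(t) + g F(s), which differs from that of f G + F g by at most d times the
    integral of |f| + |g|. Both sides are additive in the interval, so the bound globalizes, and d
    is arbitrary. No pointwise derivative is involved. *)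
Lemma is_primitiveM I f F g G : is_interval I ->
  is_primitive I f F -> is_primitive I g G ->
  is_primitive I (fun x => f x * G x + F x * g x) (fun x => F x * G x).
Proof.
move=> iI hf hg a b Ia Ib ab.
have IabI : `[a, b]%classic `<=` I.
  by move=> x /=; rewrite in_itv/= => xab; apply: iI xab.
have hf' := is_primitiveS IabI hf; have hg' := is_primitiveS IabI hg.
have cF := is_primitive_continuous ab hf'.
have cG := is_primitive_continuous ab hg'.
have [if_ _] := hf _ _ Ia Ib ab; have [ig_ _] := hg _ _ Ia Ib ab.
have cptab : compact (`[a, b]%classic : set R) by exact: segment_compact.
have prodint (p P : R -> R) : {within `[a, b], continuous P} ->
    mu.-integrable `[a, b] (EFin \o p) ->
    mu.-integrable `[a, b] (EFin \o (fun x => p x * P x)).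
  move=> cP ip.
  apply: integrableMl_EFin => //.
    by apply: subspace_continuous_measurable_fun.
  have [M [Mr hM]] := compact_bounded (continuous_compact cP cptab).
  by exists M; split => // r Mr' x xab; apply: (hM r Mr'); exists x.
have iffg : mu.-integrable `[a, b]
    (EFin \o (fun x => f x * G x + F x * g x)).
  apply: integrableD_EFin => //; first exact: prodint.
  rewrite (_ : (fun x => F x * g x) = (fun x => g x * F x)); first exact: prodint.
  by apply/funext => x; rewrite mulrC.
split => //; apply/eqP; rewrite -subr_eq0 -normr_le0; apply/ler_addgt0Pl => /= e e0.
rewrite addr0.
have iN : mu.-integrable `[a, b] (EFin \o (fun x => `|f x| + `|g x|)).
  by apply: integrableD_EFin => //; [exact: (integrable_norm if_)|
    exact: (integrable_norm ig_)].
set K := \int[mu]_(x in `[a, b]) (`|f x| + `|g x|).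
have K0 : 0 <= K by apply: Rintegral_ge0 => x _; exact: addr_ge0.
(* The denominator is [K + 1] because [K] may vanish; all that matters is [d * K <= e]. *)
pose d := e / (K + 1).
have d0 : 0 < d by rewrite divr_gt0//; lra.
apply: (@le_trans _ _ (d * K)); last first.
  by rewrite /d -mulrAC ler_pdivrMr; [nra|lra].
apply: (@additive_local_bound
  (fun s t => F t * G t - F s * G s -
              \int[mu]_(x in `[s, t]) (f x * G x + F x * g x))
  (fun s t => d * \int[mu]_(x in `[s, t]) (`|f x| + `|g x|))) => //.
- move=> s t u as_ st tu ub; rewrite (Rint_split st tu); first ring.
  exact: integrable_subitv iffg.
- move=> s t u as_ st tu ub; rewrite (Rint_split st tu); first ring.
  exact: integrable_subitv iN.
move=> c cab.
have near_osc (P : R -> R) : {within `[a, b], continuous P} -> exists2 eta : R, 0 < eta &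
    forall x, a <= x <= b -> `|x - c| < eta -> `|P x - P c| < d / 2.
  move=> /subspace_continuousP /(_ c) h.
  have /cvgrPdist_lt /(_ (d / 2)) : P x @[x --> within `[a, b] (nbhs c)] --> P c.
    by apply: h; rewrite /= in_itv.
  rewrite divr_gt0// => /(_ isT); rewrite near_withinE => /nbhs_ballP[eta /= eta0 H].
  exists eta => // x xab xc; rewrite distrC; apply: H.
    by rewrite /ball/= distrC.
  by rewrite /= in_itv.
have [r1 r10 h1] := near_osc _ cF; have [r2 r20 h2] := near_osc _ cG.
exists (Num.min r1 r2); first by rewrite lt_min r10.
move=> s t as_ sc ct tb; rewrite lt_min => /andP[st1 st2].
have osc (P : R -> R) r : (forall x, a <= x <= b -> `|x - c| < r -> `|P x - P c| < d / 2) ->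
    t - s < r -> forall x y, s <= x <= t -> s <= y <= t -> `|P x - P y| <= d.
  move=> h str x y /andP[sx xt] /andP[sy yt].
  have hc z : s <= z <= t -> `|P z - P c| < d / 2.
    move=> /andP[sz zt]; apply: h; first by rewrite (le_trans as_ sz) (le_trans zt tb).
    by rewrite ltr_norml; lra.
  have -> : P x - P y = (P x - P c) - (P y - P c) by ring.
  rewrite (le_trans (ler_normB _ _))//.
  by have := hc x; have := hc y; rewrite sx xt sy yt; lra.
have oF := osc _ _ h1 st1; have oG := osc _ _ h2 st2.
have st := le_trans sc ct.
have [Is It] : I s /\ I t.
  by split; apply: IabI; rewrite /= in_itv/=; apply/andP; split;
    rewrite // ?(le_trans st)// (le_trans as_).
have [ifs eF] := hf _ _ Is It st; have [igs eG] := hg _ _ Is It st.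
have iffgs := integrable_subitv as_ tb iffg.
(* Exact splitting: F(t)G(t) - F(s)G(s) = (F(t) - F(s)) G(t) + F(s) (G(t) - G(s)). *)
have -> : F t * G t - F s * G s - \int[mu]_(x in `[s, t]) (f x * G x + F x * g x) =
    \int[mu]_(x in `[s, t]) ((f x * G t + g x * F s) - (f x * G x + F x * g x)).
  have i2 : mu.-integrable `[s, t] (EFin \o (fun x => f x * G t + g x * F s)).
    by apply: integrableD_EFin => //; exact: integrableZr_EFin.
  rewrite RintegralB//; congr (_ - _).
  rewrite RintegralD//; [|exact: integrableZr_EFin|exact: integrableZr_EFin].
  by rewrite !RintegralZr// -eF -eG; ring.
have iD : mu.-integrable `[s, t] (EFin \o (fun x =>
    (f x * G t + g x * F s) - (f x * G x + F x * g x))).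
  by do 2?[apply: integrableB_EFin => //|apply: integrableD_EFin => //];
    exact: integrableZr_EFin.
apply: le_trans (le_normr_Rintegral _ iD) _ => //.
rewrite -RintegralZl//; last exact: integrable_subitv iN.
apply: le_Rintegral => //.
- exact: (integrable_norm iD).
- by apply: integrableZl_EFin => //; exact: integrable_subitv iN.
move=> x; rewrite /= in_itv/= => xst.
have -> : f x * G t + g x * F s - (f x * G x + F x * g x) =
  f x * (G t - G x) + g x * (F s - F x) by ring.
apply: le_trans (ler_normD _ _) _.
rewrite [leRHS]mulrDr !normrM lerD//.
- by rewrite mulrC ler_wpM2r// oG// st lexx.
- by rewrite mulrC ler_wpM2r// oF// st lexx.
Qed.

End primitives.

(** * A Volterra equation *)

Section volterra.
Context {R : realType}.
Notation mu := (@lebesgue_measure R).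
Implicit Types (f g p q : R -> R) (x y X : R).

Lemma continuous_bounded_itv f a b : continuous f ->
  exists2 M, 0 < M & forall x, a <= x <= b -> `|f x| <= M.
Proof.
move=> cf; have [ba|ab] := ltP b a.
  exists 1 => // x /andP[ax xb].
  by have := le_lt_trans (le_trans ax xb) ba; rewrite ltxx.
have cf' : {within `[a, b], continuous f} by exact: continuous_subspaceT.
have [M [Mr hM]] := compact_bounded (continuous_compact cf' (@segment_compact _ a b)).
exists (`|M| + 1) => [|x xab]; first by rewrite ltr_wpDl.
apply: (hM (`|M| + 1)); first by rewrite (le_lt_trans (ler_norm M))// ltrDl.
by exists x => //; rewrite /= in_itv.
Qed.

(** For x < 0 the interval is empty and the value is 0, so the result is continuous on the whole
    line and half-line problems can be treated with globally continuous functions. *)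
Definition int0 f x := \int[mu]_(t in `[0, x]) f t.

Lemma int0_neg f x : x < 0 -> int0 f x = 0.
Proof.
by move=> x0; rewrite /int0 set_itv_ge ?Rintegral_set0// bnd_simp -ltNge.
Qed.

Lemma int0_lip f M X : continuous f -> 0 <= M ->
  (forall x, 0 <= x <= X -> `|f x| <= M) ->
  forall x y, x <= y -> y <= X -> `|int0 f y - int0 f x| <= M * (y - x).
Proof.
move=> cf M0 fM x y xy yX.
have [y0|y0] := ltP y 0.
  rewrite !int0_neg ?(le_lt_trans xy y0)// subrr normr0.
  by rewrite mulr_ge0// subr_ge0.
have bnd s : 0 <= s -> s <= y ->
    `|\int[mu]_(t in `[s, y]) f t| <= M * (y - s).
  move=> s0 sy; apply: Rint_le_cst => //; first exact: continuous_integrable_itv.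
  by move=> z /andP[sz zy]; rewrite fM// (le_trans s0 sz) (le_trans zy yX).
have [x0|x0] := ltP x 0.
  rewrite (int0_neg _ x0) subr0 (le_trans (bnd _ _ _))// subr0.
  by rewrite ler_wpM2l//; lra.
rewrite {1}/int0 (Rint_split x0 xy); last exact: continuous_integrable_itv.
by rewrite -/(int0 f x) addrAC subrr add0r bnd.
Qed.

Lemma continuous_int0 f : continuous f -> continuous (int0 f).
Proof.
move=> cf x; have [M M0 fM] := continuous_bounded_itv 0 (x + 1) cf.
have lip := int0_lip cf (ltW M0) fM.
apply/cvgrPdist_lt => /= e e0.
near=> y.
have yx1 : `|x - y| < 1 by near: y; apply: cvgr_dist_lt => //; exact: cvg_id.
have yxM : `|x - y| < e / M.
  by near: y; apply: cvgr_dist_lt; rewrite ?divr_gt0//; exact: cvg_id.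
have Mxy : M * `|x - y| < e by rewrite mulrC -ltr_pdivlMr.
apply: le_lt_trans Mxy.
have [xy|yx] := leP x y.
  rewrite distrC (distrC x) (ger0_norm (_ : 0 <= y - x)) ?subr_ge0//.
  by apply: lip => //; move: yx1; rewrite ltr_norml; lra.
rewrite (ger0_norm (_ : 0 <= x - y)) ?subr_ge0 ?(ltW yx)//.
by apply: lip; [exact: ltW|lra].
Unshelve. all: by end_near. Qed.

Lemma geometric_cauchy (u : nat -> R) D :
  (forall n, `|u n.+1 - u n| <= D / 2 ^+ n) ->
  cvgn u /\ forall n, `|limn u - u n| <= 2 * D / 2 ^+ n.
Proof.
move=> uD.
have D0 : 0 <= D by have := le_trans (normr_ge0 _) (uD 0%N); rewrite expr0 divr1.
(* The factor 1 - 1/2^k is the exact partial geometric sum; without it the induction does not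
   close. *)
have tail n k : `|u (n + k)%N - u n| <= 2 * D / 2 ^+ n * (1 - 1 / 2 ^+ k).
  elim: k => [|k IH]; first by rewrite addn0 subrr normr0 expr0; lra.
  rewrite (_ : _ - _ = (u (n + k).+1 - u (n + k)%N) + (u (n + k)%N - u n)); last first.
    by rewrite addnS; ring.
  apply: le_trans (ler_normD _ _) _.
  apply: le_trans (lerD (uD _) IH) _.
  rewrite exprD exprS le_eqVlt; apply/orP; left; apply/eqP.
  by field; rewrite !expf_neq0//.
have tail' n k : `|u (n + k)%N - u n| <= 2 * D / 2 ^+ n.
  apply: le_trans (tail n k) _; apply: ler_piMr.
    by rewrite divr_ge0// ?mulr_ge0// exprn_ge0.
  by rewrite gerBl divr_ge0// exprn_ge0.
have g0 : (2 * D / 2 ^+ n) @[n --> \oo] --> (0 : R).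
  have := @cvg_geometric R (2 * D) (2^-1).
  rewrite ger0_norm ?invr_ge0// invf_lt1// ltr1n => /(_ isT).
  by apply: cvg_trans; apply: near_eq_cvg; near=> n; rewrite /= exprVn.
have cu : cvgn u.
  apply/cauchy_cvgP/cauchy_exP => e e0.
  have /cvgrPdist_lt /(_ e e0) [n _ /(_ n (leqnn n))/=] := g0.
  rewrite sub0r normrN ger0_norm; last by rewrite divr_ge0// ?mulr_ge0// exprn_ge0.
  move=> ne; exists (u n), n => // m /= nm.
  by rewrite /ball/= distrC -(subnKC nm) (le_lt_trans (tail' _ _)).
split => // n.
have cn : `|u m - u n| @[m --> \oo] --> `|limn u - u n|.
  by apply: cvg_norm; apply: cvgB => //; exact: cvg_cst.
rewrite -(cvg_lim _ cn)//; apply: limr_le; first exact: cvgP cn.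
by exists n => // m /= nm; rewrite -(subnKC nm) tail'.
Unshelve. all: by end_near. Qed.

Lemma int0_expR K x : 0 < K -> 0 <= x ->
  int0 (fun t => expR (K * t)) x <= expR (K * x) / K.
Proof.
move=> K0; rewrite le_eqVlt => /predU1P[<-|x0].
  by rewrite /int0 set_itv1 Rintegral_set1 divr_ge0 ?expR_ge0// ltW.
have dK (t : R) : is_derive t (1 : R) (fun s : R => expR (K * s) / K) (expR (K * t)).
  have dl : is_derive t (1 : R) ( *%R K) K.
    by apply: is_derive_eq (is_deriveZ K (is_derive_id t (1 : R))) _; exact: mulr1.
  have h := is_deriveZ K^-1 (is_derive1_comp (is_derive_expR (K * t)) dl).
  have -> : (fun s => expR (K * s) / K) = K^-1 \*: (expR \o ( *%R K)).
    by apply/funext => s; exact: mulrC.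
  apply: (is_derive_eq h).
  by rewrite (_ : K^-1 *: _ = K^-1 * (expR (K * t) * K))// mulrC mulfK ?gt_eqF.
have cE : continuous (fun t : R => expR (K * t)).
  move=> t; apply: continuous_comp; last exact: continuous_expR.
  exact: mulrl_continuous.
have cEK : continuous (fun t : R => expR (K * t) / K).
  by move=> t; apply: cvgM; [exact: cE|exact: cvg_cst].
rewrite /int0 /Rintegral (@continuous_FTC2 _ _ (fun s => expR (K * s) / K))//.
- by rewrite /= mulr0 expR0 gerBl divr_ge0// ltW.
- exact: continuous_subspaceT.
- split.
  + by move=> t _; case: (dK t).
  + by apply: cvg_at_right_filter; exact: cEK.
  + by apply: cvg_at_left_filter; exact: cEK.
- by move=> t _; rewrite derive1E; case: (dK t).
Qed.

Section picard.
Variables (u0 a b p q : R -> R).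
Hypotheses (cu0 : continuous u0) (ca : continuous a) (cb : continuous b).
Hypotheses (cp : continuous p) (cq : continuous q).

(** Variation of parameters eliminated down to one scalar unknown: with p = - V b / W and q = V a /
    W a fixed point is the perturbed solution u, and the two integrals give back z1 and z2 up to
    their initial values. *)
Definition volterra f x :=
  u0 x + a x * int0 (fun t => p t * f t) x + b x * int0 (fun t => q t * f t) x.

Definition picard n := iter n volterra u0.

Lemma picardS n : picard n.+1 = volterra (picard n).
Proof. by rewrite /picard iterS. Qed.

Definition volterra_sol x := limn (fun n => picard n x).

Lemma continuous_volterra f : continuous f -> continuous (volterra f).
Proof.
move=> cf x; apply: cvgD; first apply: cvgD; first exact: cu0.
- by apply: cvgM; [exact: ca|apply: continuous_int0 => y; apply: cvgM;
    [exact: cp|exact: cf]].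
- by apply: cvgM; [exact: cb|apply: continuous_int0 => y; apply: cvgM;
    [exact: cq|exact: cf]].
Qed.

Lemma continuous_picard n : continuous (picard n).
Proof. by elim: n => // n; exact: continuous_volterra. Qed.

Lemma int0B_le g f1 f2 M x : continuous g -> continuous f1 -> continuous f2 ->
  (forall t, 0 <= t <= x -> `|g t| <= M) ->
  `|int0 (fun t => g t * f1 t) x - int0 (fun t => g t * f2 t) x| <=
  M * int0 (fun t => `|f1 t - f2 t|) x.
Proof.
move=> cg cf1 cf2 gM; rewrite /int0 -RintegralB//; last 2 first.
  by apply: continuous_integrable_itv => y; apply: cvgM; [exact: cg|exact: cf1].
  by apply: continuous_integrable_itv => y; apply: cvgM; [exact: cg|exact: cf2].
have cD : continuous (fun t => g t * f1 t - g t * f2 t).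
  by move=> y; apply: cvgB; apply: cvgM; [exact: cg|exact: cf1|exact: cg|exact: cf2].
have cN : continuous (fun t => `|f1 t - f2 t|).
  by move=> y; apply: cvg_norm; apply: cvgB; [exact: cf1|exact: cf2].
have iD : mu.-integrable `[0, x] (EFin \o (fun t => g t * f1 t - g t * f2 t)).
  exact: continuous_integrable_itv.
apply: le_trans (le_normr_Rintegral _ iD) _ => //.
rewrite -RintegralZl//; last exact: continuous_integrable_itv.
apply: le_Rintegral => //.
- exact: (integrable_norm iD).
- by apply: integrableZl_EFin => //; exact: continuous_integrable_itv.
move=> t; rewrite /= in_itv/= => tx.
by rewrite -mulrBr normrM ler_wpM2r// gM.
Qed.

Lemma volterra_contraction X : exists2 K, 0 < K &
  forall f1 f2, continuous f1 -> continuous f2 -> forall x, x <= X ->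
  `|volterra f1 x - volterra f2 x| <= K * int0 (fun t => `|f1 t - f2 t|) x.
Proof.
have [A A0 aA] := continuous_bounded_itv 0 X ca.
have [B B0 bB] := continuous_bounded_itv 0 X cb.
have [P P0 pP] := continuous_bounded_itv 0 X cp.
have [Q Q0 qQ] := continuous_bounded_itv 0 X cq.
exists (A * P + B * Q); first by rewrite addr_gt0// mulr_gt0.
move=> f1 f2 cf1 cf2 x xX.
have [x0|x0] := ltP x 0.
  by rewrite /volterra !int0_neg// !mulr0 subrr normr0.
rewrite (_ : _ - _ =
  a x * (int0 (fun t => p t * f1 t) x - int0 (fun t => p t * f2 t) x) +
  b x * (int0 (fun t => q t * f1 t) x - int0 (fun t => q t * f2 t) x)); last first.
  by rewrite /volterra; ring.
have sub r M : (forall t, 0 <= t <= X -> `|r t| <= M) ->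
    forall t, 0 <= t <= x -> `|r t| <= M.
  by move=> h t /andP[t0 tx]; rewrite h// t0 (le_trans tx).
apply: le_trans (ler_normD _ _) _; rewrite mulrDl !normrM -!mulrA.
apply: lerD; apply: ler_pM => //.
- by apply: aA; rewrite x0.
- by apply: int0B_le => //; exact: sub pP.
- by apply: bB; rewrite x0.
- by apply: int0B_le => //; exact: sub qQ.
Qed.

(** In the norm weighted by exp(2Kx) the operator contracts by 1/2, because K times the integral of
    exp(2Kt) over [0, x] is at most exp(2Kx) / 2. This covers any X without cutting [0, X] into
    short pieces. *)
Lemma picard_step X : exists2 D, 0 <= D & forall n x, x <= X ->
  `|picard n.+1 x - picard n x| <= D / 2 ^+ n.
Proof.
have [K K0 hK] := volterra_contraction X.
have cd : continuous (fun x => picard 1 x - picard 0 x).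
  by move=> y; apply: cvgB; exact: continuous_picard.
have [D D0 hD] := continuous_bounded_itv 0 X cd.
have K2 : 0 < 2 * K by rewrite mulr_gt0.
have weighted n x : 0 <= x <= X ->
    `|picard n.+1 x - picard n x| <= D / 2 ^+ n * expR (2 * K * x).
  elim: n x => [|n IH] x xX.
    rewrite expr0 divr1 (le_trans (hD _ xX))// ler_peMr ?(ltW D0)//.
    by rewrite -[leLHS]expR0 ler_expR mulr_ge0 ?(ltW K2)//; case/andP: xX.
  case/andP: (xX) => x0 xX'.
  have step := hK _ _ (@continuous_picard n.+1) (@continuous_picard n) x xX'.
  apply: (le_trans step).
  have cE : continuous (fun t => expR (2 * K * t)).
    move=> t; apply: continuous_comp; last exact: continuous_expR.
    exact: mulrl_continuous.
  have : int0 (fun t => `|picard n.+1 t - picard n t|) x <=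
      D / 2 ^+ n * int0 (fun t => expR (2 * K * t)) x.
    rewrite /int0 -RintegralZl//; last exact: continuous_integrable_itv.
    apply: le_Rintegral => //.
    - apply: continuous_integrable_itv => t; apply: cvg_norm.
      by apply: cvgB; exact: continuous_picard.
    - by apply: integrableZl_EFin => //; exact: continuous_integrable_itv.
    move=> t; rewrite /= in_itv/= => /andP[t0 tx].
    by rewrite IH// t0 (le_trans tx).
  have Dn0 : 0 <= D / 2 ^+ n by rewrite divr_ge0 ?(ltW D0)// exprn_ge0.
  move=> /le_trans/(_ (ler_wpM2l Dn0 (int0_expR K2 x0))) h.
  apply: le_trans (ler_wpM2l (ltW K0) h) _.
  rewrite exprS le_eqVlt; apply/orP; left; apply/eqP.
  by field; rewrite expf_neq0//= gt_eqF.
exists (D * expR (2 * K * X)) => [|n x xX].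
  by rewrite mulr_ge0 ?expR_ge0 ?ltW.
have [x0|x0] := ltP x 0.
  have e m : picard m x = u0 x.
    by case: m => // m; rewrite /picard /= /volterra !int0_neg// !mulr0 !addr0.
  by rewrite !e subrr normr0 divr_ge0// ?exprn_ge0// mulr_ge0 ?expR_ge0 ?ltW.
apply: le_trans (weighted n x _) _; first by rewrite x0.
rewrite -mulrA (mulrC _^-1) mulrA ler_wpM2r ?invr_ge0 ?exprn_ge0//.
rewrite ler_wpM2l ?(ltW D0)// ler_expR ler_wpM2l// ltW//.
Qed.

Lemma volterra_sol_close X : exists2 D, 0 <= D & forall n x, x <= X ->
  `|volterra_sol x - picard n x| <= D / 2 ^+ n.
Proof.
have [D D0 hD] := picard_step X; exists (2 * D); first exact: mulr_ge0.
by move=> n x xX; have [_] := geometric_cauchy (fun n => hD n x xX); exact.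
Qed.

Lemma small_geometric (D e : R) : 0 <= D -> 0 < e -> exists n, D / 2 ^+ n < e.
Proof.
move=> D0 e0; have := @cvg_geometric R D (2^-1).
rewrite ger0_norm ?invr_ge0// invf_lt1// ltr1n => /(_ isT).
move=> /cvgrPdist_lt /(_ e e0) [n _ /(_ n (leqnn n))/=].
rewrite sub0r normrN ger0_norm; last by rewrite mulr_ge0 ?exprn_ge0.
by rewrite exprVn; exists n.
Qed.

Lemma continuous_volterra_sol : continuous volterra_sol.
Proof.
move=> x; have [D D0 hD] := volterra_sol_close (x + 1).
apply/cvgrPdist_lt => /= e e0.
have e3 : 0 < e / 3 by rewrite divr_gt0.
have [n nD] := small_geometric D0 e3.
near=> y.
have yx1 : `|x - y| < 1 by near: y; apply: cvgr_dist_lt => //; exact: cvg_id.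
have yn : `|picard n x - picard n y| < e / 3.
  near: y; apply: cvgr_dist_lt => //; exact: continuous_picard.
have hx := hD n x; have hy := hD n y.
rewrite (_ : _ - _ = (volterra_sol x - picard n x) +
  (picard n x - picard n y) - (volterra_sol y - picard n y)); last by ring.
have {}hx := le_lt_trans (hx _) nD; have {}hy := le_lt_trans (hy _) nD.
have xx : x <= x + 1 by lra.
have yy : y <= x + 1 by move: yx1; rewrite ltr_norml; lra.
have := hx xx; have := hy yy.
have := ler_normB ((volterra_sol x - picard n x) +
  (picard n x - picard n y)) (volterra_sol y - picard n y).
have := ler_normD (volterra_sol x - picard n x) (picard n x - picard n y).
lra.
Unshelve. all: by end_near. Qed.

Lemma volterra_solE x : volterra_sol x = volterra volterra_sol x.
Proof.
have [D D0 hD] := volterra_sol_close x.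
have [K K0 hK] := volterra_contraction x.
apply/eqP; rewrite -subr_eq0 -normr_le0; apply/ler_addgt0Pl => /= e e0.
rewrite addr0.
(* The first summand pays for the distance to iterate n + 1, the second for one application of
   [volterra] to functions that differ by at most D / 2^n on [0, x]. *)
have C0 : 0 <= D + K * (D * `|x|) by rewrite addr_ge0// mulr_ge0 ?(ltW K0)// mulr_ge0.
have [n nD] := small_geometric C0 e0.
rewrite (_ : _ - _ = (volterra_sol x - picard n.+1 x) +
  (volterra (picard n) x - volterra volterra_sol x)); last first.
  by rewrite /picard /=; ring.
apply: le_trans (ler_normD _ _) _; apply: ltW; apply: le_lt_trans nD.
rewrite mulrDl; apply: lerD.
  apply: le_trans (hD _ _ _) _ => //.
  rewrite ler_wpM2l// exprS invfM ler_piMl ?invr_ge0 ?exprn_ge0//.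
  by rewrite invf_le1// ler1n.
apply: le_trans (hK _ _ (@continuous_picard n) continuous_volterra_sol _ (lexx x)) _.
rewrite -mulrA ler_wpM2l ?(ltW K0)//.
have [x0|x0] := ltP x 0.
  by rewrite int0_neg// divr_ge0 ?exprn_ge0// mulr_ge0.
have cN : continuous (fun t => `|picard n t - volterra_sol t|).
  move=> y; apply: cvg_norm; apply: cvgB; first exact: continuous_picard.
  exact: continuous_volterra_sol.
apply: le_trans (ler_norm _) _.
rewrite (ger0_norm x0) mulrAC -[X in _ * X]subr0.
apply: Rint_le_cst => //; first exact: continuous_integrable_itv.
by move=> t /andP[t0 tx]; rewrite normr_id distrC hD.
Qed.

End picard.

(** Causality, inherited from the Picard iterates. It is what lets the potential beyond X be chosen
    from values of the solution up to X. *)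
Lemma volterra_sol_local u0 a b p q p' q' X :
  (forall x, 0 <= x <= X -> p x = p' x) ->
  (forall x, 0 <= x <= X -> q x = q' x) ->
  forall x, x <= X -> volterra_sol u0 a b p q x = volterra_sol u0 a b p' q' x.
Proof.
move=> hp hq x xX; rewrite /volterra_sol.
suff e n (y : R) : y <= X -> picard u0 a b p q n y = picard u0 a b p' q' n y.
  rewrite (_ : (fun n => picard u0 a b p q n x) = (fun n => picard u0 a b p' q' n x))//.
  by apply/funext => n; exact: e.
elim: n y => [//|n IH y yX].
rewrite !picardS.
have same (r r' : R -> R) : (forall t, 0 <= t <= X -> r t = r' t) ->
    int0 (fun t => r t * picard u0 a b p q n t) y =
    int0 (fun t => r' t * picard u0 a b p' q' n t) y.
  move=> hr; apply: eq_Rintegral => t.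
  rewrite inE/= in_itv/= => /andP[t0 ty]; have tX := le_trans ty yX.
  by rewrite hr ?t0// (IH t tX).
by rewrite /volterra (same _ _ hp) (same _ _ hq).
Qed.

End volterra.

(** * Smooth functions with compact support *)

Section smooth.
Context {R : realType}.
Implicit Types (f g : R -> R) (x : R).

(** A finite order is tracked for the sake of induction: the derivative of a product mixes
    derivatives with undifferentiated factors, so the induction hypothesis must apply to both at the
    lower order. *)
Definition smooth_upto n f :=
  forall m, (m <= n)%N -> forall x, derivable (derive1n m f) x 1.

Definition smooth f := forall n x, derivable (derive1n n f) x 1.

Lemma smooth_uptoP f : (forall n, smooth_upto n f) -> smooth f.
Proof. by move=> h n x; exact: (h n). Qed.

Lemma derivableP_R f x : derivable f x 1 -> is_derive x (1 : R) f ((derive1 f) x).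
Proof. by move=> df; rewrite derive1E; exact: derivableP. Qed.

Lemma is_deriveP_R f df : (forall x, is_derive x (1 : R) f (df x)) ->
  (forall x, derivable f x 1) /\ (derive1 f) = df.
Proof.
by move=> h; split => [x|]; [case: (h x)|apply/funext => x; rewrite derive1E;
  case: (h x)].
Qed.

Lemma smooth_uptoS n f df : (forall x, is_derive x (1 : R) f (df x)) ->
  smooth_upto n df -> smooth_upto n.+1 f.
Proof.
move=> /is_deriveP_R[d e] h [_ //|m mn x].
by rewrite derive1Sn e; exact: h.
Qed.

Lemma smooth_upto0 f df : (forall x, is_derive x (1 : R) f (df x)) ->
  smooth_upto 0 f.
Proof.
by move=> /is_deriveP_R[d _] m; rewrite leqn0 => /eqP -> x; exact: d.
Qed.

Lemma smooth_uptoW n f : smooth_upto n.+1 f -> smooth_upto n f.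
Proof. by move=> h m mn; apply: h; exact: leqW. Qed.

Lemma smooth_upto_is_derive n f x :
  smooth_upto n f -> is_derive x (1 : R) f ((derive1 f) x).
Proof. by move=> h; apply: derivableP_R; exact: (h 0%N). Qed.

Lemma smooth_upto_derive1 n f : smooth_upto n.+1 f -> smooth_upto n (derive1 f).
Proof. by move=> h m mn x; rewrite -derive1Sn; exact: h. Qed.

Lemma is_deriveD_R f g x a b : is_derive x (1 : R) f a ->
  is_derive x (1 : R) g b -> is_derive x (1 : R) (fun t => f t + g t) (a + b).
Proof. by move=> hf hg; exact: is_deriveD. Qed.

Lemma is_deriveM_R f g x a b : is_derive x (1 : R) f a ->
  is_derive x (1 : R) g b ->
  is_derive x (1 : R) (fun t => f t * g t) (a * g x + f x * b).
Proof.
move=> hf hg; have h := is_deriveM hf hg; apply: (is_derive_eq h).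
by rewrite addrC mulrC.
Qed.

Lemma is_deriveZ_R k f x a : is_derive x (1 : R) f a ->
  is_derive x (1 : R) (fun t => k * f t) (k * a).
Proof. by move=> hf; exact: is_deriveZ. Qed.

Lemma is_derive_affine k c x : is_derive x (1 : R) (fun t => k * t + c) k.
Proof.
have h := is_deriveD_R (is_deriveZ_R k (is_derive_id x (1 : R))) (is_derive_cst c x (1 : R)).
by apply: (is_derive_eq h); rewrite mulr1 addr0.
Qed.

Lemma is_derive_comp_affine f (k c x a : R) :
  is_derive (k * x + c) (1 : R) f a ->
  is_derive x (1 : R) (fun t => f (k * t + c)) (a * k).
Proof.
move=> h; have d := is_derive_affine k c x.
by have := @is_derive1_comp R f (fun t => k * t + c) x a k h d.
Qed.

Lemma smooth_uptoD n f g : smooth_upto n f -> smooth_upto n g ->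
  smooth_upto n (fun x => f x + g x).
Proof.
elim: n f g => [|n IH] f g hf hg; have df x := smooth_upto_is_derive x hf;
  have dg x := smooth_upto_is_derive x hg.
  by apply: smooth_upto0 => x; exact: is_deriveD_R.
apply: (@smooth_uptoS _ _ _ (fun x => is_deriveD_R (df x) (dg x))).
exact: IH (smooth_upto_derive1 hf) (smooth_upto_derive1 hg).
Qed.

Lemma smooth_uptoM n f g : smooth_upto n f -> smooth_upto n g ->
  smooth_upto n (fun x => f x * g x).
Proof.
elim: n f g => [|n IH] f g hf hg; have df x := smooth_upto_is_derive x hf;
  have dg x := smooth_upto_is_derive x hg.
  by apply: smooth_upto0 => x; exact: is_deriveM_R.
apply: (@smooth_uptoS _ _ _ (fun x => is_deriveM_R (df x) (dg x))).
have [hf' hg'] := (smooth_uptoW hf, smooth_uptoW hg).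
apply: smooth_uptoD.
  exact: IH (smooth_upto_derive1 hf) hg'.
exact: IH hf' (smooth_upto_derive1 hg).
Qed.

Lemma smooth_upto_cst n (c : R) : smooth_upto n (fun=> c).
Proof.
elim: n c => [|n IH] c.
  by apply: smooth_upto0 => x; exact: is_derive_cst.
exact: (@smooth_uptoS _ _ (fun=> 0) (fun x => is_derive_cst c x (1 : R))).
Qed.

Lemma smooth_upto_affine n k c f : smooth_upto n f ->
  smooth_upto n (fun x => f (k * x + c)).
Proof.
elim: n f => [|n IH] f hf; have df x := smooth_upto_is_derive x hf;
  have dfa x := is_derive_comp_affine (df (k * x + c)).
  exact: (smooth_upto0 dfa).
apply: (smooth_uptoS dfa).
apply: smooth_uptoM; last exact: smooth_upto_cst.
exact: IH (smooth_upto_derive1 hf).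
Qed.

Lemma smoothD f g : smooth f -> smooth g -> smooth (fun x => f x + g x).
Proof. by move=> hf hg; apply: smooth_uptoP => n; apply: smooth_uptoD => m _. Qed.

Lemma smoothM f g : smooth f -> smooth g -> smooth (fun x => f x * g x).
Proof. by move=> hf hg; apply: smooth_uptoP => n; apply: smooth_uptoM => m _. Qed.

Lemma smooth_cst (c : R) : smooth (fun=> c).
Proof. by apply: smooth_uptoP => n; exact: smooth_upto_cst. Qed.

Lemma smooth_affine k c f : smooth f -> smooth (fun x => f (k * x + c)).
Proof. by move=> hf; apply: smooth_uptoP => n; apply: smooth_upto_affine => m _. Qed.

Lemma smooth_sum (I : Type) (r : seq I) (F : I -> R -> R) :
  (forall i, smooth (F i)) -> smooth (fun x => \sum_(i <- r) F i x).
Proof.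
move=> hF; elim: r => [|i r IH].
  rewrite (_ : (fun x => _) = (fun=> 0)); first exact: smooth_cst.
  by apply/funext => x; rewrite big_nil.
rewrite (_ : (fun x => _) = (fun x => F i x + \sum_(j <- r) F j x)).
  exact: (smoothD (hF i) IH).
by apply/funext => x; rewrite big_cons.
Qed.

Lemma derivable_continuous f : (forall x, derivable f x 1) -> continuous f.
Proof.
by move=> h x; apply: differentiable_continuous; apply/derivable1_diffP; exact: h.
Qed.

Lemma smooth_continuous f n : smooth f -> continuous (derive1n n f).
Proof. by move=> h; apply: derivable_continuous; exact: h. Qed.

Lemma near_eq_derive1n f g x n : (\near x, f x = g x) ->
  \near x, derive1n n f x = derive1n n g x.
Proof.
elim: n => // n IH fg.
have /near_join := IH fg; apply: filterS => y h.
by rewrite !derive1nS !derive1E; exact: near_eq_derive.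
Qed.

(** Smoothness is local; this is how the locally finite infinite sum of bumps is seen to be
    smooth. *)
Lemma near_eq_smooth f :
  (forall x, exists2 g, smooth g & \near x, f x = g x) -> smooth f.
Proof.
move=> h n x; have [g sg fg] := h x.
apply: near_eq_derivable (sg n x); apply: near_eq_derive1n.
by apply: filterS fg => y ->.
Qed.

Lemma smooth_smooth_half_line f : smooth f -> smooth_half_line f.
Proof.
move=> sf; have cf n := @smooth_continuous f n sf.
split => [n x _|//|n].
- exact: sf.
- exact: (cvg_at_right_filter (@cf 0%N 0)).
- by apply: cvgP; apply: cvg_at_right_filter; exact: cf.
Qed.

(** * A smooth bump function *)

(** The classical exp(-1/x) is the case k = 0. The powers of 1/x are included because the span of
    the family is closed under differentiation, so one induction proves all members smooth. *)
Definition flat k x : R := if 0 < x then x^-1 ^+ k * expR (- x^-1) else 0.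

Lemma flat_ge0 k x : 0 <= flat k x.
Proof.
rewrite /flat; case: ifPn => // x0.
by rewrite mulr_ge0 ?expR_ge0// exprn_ge0// invr_ge0 ltW.
Qed.

(** The term of degree k + 2 in the exponential series at 1/x leaves two powers of x to spare. A
    quadratic bound is what makes the derivative at the origin vanish. *)
Lemma flat_bound k x : flat k x <= k.+2`!%:R * x ^+ 2.
Proof.
rewrite /flat; case: ifPn => [x0|_]; last by rewrite mulr_ge0// sqr_ge0.
rewrite expRN ler_pdivrMr ?expR_gt0//.
have y0 : 0 <= x^-1 by rewrite invr_ge0 ltW.
have := expR_ge1Dxn k.+1 y0.
have f0 : 0 < k.+2`!%:R :> R by rewrite ltr0n fact_gt0.
move=> h; have {}h : x^-1 ^+ k.+2 / k.+2`!%:R <= expR x^-1.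
  by apply: le_trans h; rewrite lerDr.
move: h; rewrite ler_pdivrMr// => h.
have := ler_wpM2l (sqr_ge0 x) h.
rewrite (_ : x ^+ 2 * _ = x^-1 ^+ k); last first.
  by rewrite -(addn2 k) exprD mulrCA -exprMn mulfV ?gt_eqF// expr1n mulr1.
by move=> /le_trans; apply; rewrite le_eqVlt; apply/orP; left; apply/eqP; ring.
Qed.

Lemma is_derive_flat k x :
  is_derive x (1 : R) (flat k) (- k%:R * flat k.+1 x + flat k.+2 x).
Proof.
have [x0|x0|->] := ltgtP x 0.
- have -> : - k%:R * flat k.+1 x + flat k.+2 x = 0.
    by rewrite /flat ltNge (ltW x0)/= mulr0 addr0.
  apply: (near_eq_is_derive _ (is_derive_cst (0 : R) x (1 : R))).
  near=> y; rewrite /flat ifF//; apply/negbTE; rewrite -leNgt ltW//.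
  by near: y; exact: lt_nbhsl.
- apply: (@near_eq_is_derive _ _ _ (fun x => x^-1 ^+ k * expR (- x^-1))).
    by near=> y; rewrite /flat ifT//; near: y; exact: lt_nbhsr.
  have dV : is_derive x (1 : R) (fun y : R => y^-1) (- x^-1 ^+ 2).
    have h := is_deriveV (lt0r_neq0 x0) (is_derive_id x (1 : R)).
    by apply: (is_derive_eq h); rewrite [LHS]mulr1 exprVn.
  have dE : is_derive x (1 : R) (fun y : R => expR (- y^-1)) (expR (- x^-1) * x^-1 ^+ 2).
    have d1 := is_deriveZ_R (-1) dV.
    have h := @is_derive1_comp R expR (fun y => -1 * y^-1) x _ _
      (is_derive_expR (-1 * x^-1)) d1.
    rewrite (_ : (fun y => _) = expR \o (fun y => -1 * y^-1)); last first.
      by apply/funext => y /=; rewrite mulN1r.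
    by apply: (is_derive_eq h); rewrite !mulN1r opprK.
  have dX : is_derive x (1 : R) (fun y : R => y^-1 ^+ k) (- k%:R * x^-1 ^+ k.+1).
    have h := is_deriveX k dV.
    rewrite (_ : (fun y => _) = (fun y : R => y^-1) ^+ k); last first.
      by apply/funext => y; rewrite exprfctE.
    apply: (is_derive_eq h); rewrite [LHS]mulrN mulNr; congr (- _).
    clear h; case: k => [|k]; first by rewrite !mul0r.
    by rewrite -mulrA -exprD addn2.
  have h := is_deriveM_R dX dE; apply: (is_derive_eq h).
  rewrite /flat x0 !exprS expr0; ring.
- have -> : - k%:R * flat k.+1 0 + flat k.+2 0 = 0 :> R.
    by rewrite /flat ltxx mulr0 addr0.
  have lim0 : h^-1 *: (flat k (h *: 1 + 0) - flat k 0) @[h --> 0^'] --> (0 : R).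
    apply/cvgrPdist_lt => /= e e0.
    have C0 : 0 < k.+2`!%:R :> R by rewrite ltr0n fact_gt0.
    near=> h.
    have h0 : h != 0 by near: h; exact: nbhs_dnbhs_neq.
    have he : `|h| < e / k.+2`!%:R.
      near: h; apply: dnbhs0_lt; exact: divr_gt0.
    rewrite sub0r normrN addr0 (_ : _ *: 1 = h); last exact: mulr1.
    rewrite [flat k 0](_ : _ = 0) ?subr0; last by rewrite /flat ltxx.
    rewrite (_ : _ *: _ = h^-1 * flat k h)// normrM normfV (ger0_norm (flat_ge0 _ _)).
    rewrite mulrC ltr_pdivrMr ?normr_gt0//.
    apply: le_lt_trans (flat_bound k h) _.
    rewrite -real_normK ?num_real// expr2 mulrA ltr_pM2r ?normr_gt0//.
    by rewrite mulrC -ltr_pdivlMr.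
  by apply: DeriveDef; [exact: cvgP lim0|exact: cvg_lim lim0].
Unshelve. all: by end_near. Qed.

Lemma smooth_flat k : smooth (flat k).
Proof.
apply: smooth_uptoP => n; elim: n k => [|n IH] k.
  by apply: smooth_upto0 => x; exact: is_derive_flat.
apply: (smooth_uptoS (is_derive_flat k)).
by apply: smooth_uptoD => //; apply: smooth_uptoM => //; exact: smooth_upto_cst.
Qed.

Definition mollifier (l r x : R) := flat 0 (x - l) * flat 0 (r - x).

Lemma smooth_mollifier l r : smooth (mollifier l r).
Proof.
apply: smoothM.
  rewrite (_ : (fun x => _) = (fun x => flat 0 (1 * x + - l))).
    exact: smooth_affine (@smooth_flat 0).
  by apply/funext => x; rewrite mul1r.
rewrite (_ : (fun x => _) = (fun x => flat 0 (- 1 * x + r))).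
  exact: smooth_affine (@smooth_flat 0).
by apply/funext => x; rewrite mulN1r addrC.
Qed.

Lemma mollifier_ge0 l r x : 0 <= mollifier l r x.
Proof. by rewrite mulr_ge0 ?flat_ge0. Qed.

Lemma flat0_le1 x : flat 0 x <= 1.
Proof.
rewrite /flat expr0 mul1r; case: ifPn => // x0.
by rewrite -[leRHS]expR0 ler_expR oppr_le0 invr_ge0 ltW.
Qed.

Lemma mollifier_le1 l r x : mollifier l r x <= 1.
Proof. by rewrite mulr_ile1 ?flat_ge0 ?flat0_le1. Qed.

Lemma mollifier_out l r x : ~~ (l < x < r) -> mollifier l r x = 0.
Proof.
rewrite negb_and -!leNgt /mollifier /flat => /orP[h|h].
  by rewrite [in X in X * _]ifF ?mul0r// subr_gt0; apply/negbTE; rewrite -leNgt.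
by rewrite [in X in _ * X]ifF ?mulr0// subr_gt0; apply/negbTE; rewrite -leNgt.
Qed.

Lemma mollifier_gt0 l r x : l < x < r -> 0 < mollifier l r x.
Proof.
move=> /andP[lx xr]; rewrite /mollifier /flat !subr_gt0 lx xr !expr0 !mul1r.
by rewrite mulr_gt0 ?expR_gt0.
Qed.

End smooth.

(** * Floquet solutions *)

Section floquet.
Context {R : realType}.
Notation mu := (@lebesgue_measure R).
Implicit Types (q u v : R -> R) (E x : R).

Lemma is_primitive0_cst (F : R -> R) : is_primitive setT (fun=> 0) F ->
  forall x y, F x = F y.
Proof.
move=> h; suff H x y : x <= y -> F x = F y.
  by move=> x y; case: (leP x y) => [/H//|/ltW/H].
move=> xy; have [_] := h x y I I xy.
by rewrite Rintegral_cst// mul0r => /eqP; rewrite subr_eq0 => /eqP.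
Qed.

Lemma wronskian_cst q E u1 v1 u2 v2 :
  schrodinger_pair q E setT u1 v1 -> schrodinger_pair q E setT u2 v2 ->
  forall x y, u1 x * v2 x - v1 x * u2 x = u1 y * v2 y - v1 y * u2 y.
Proof.
move=> [h1 h1'] [h2 h2'].
have iT : is_interval [set: R] by [].
have d1 := is_primitiveM iT h1 h2'.
have d2 := is_primitiveZ (-1) (is_primitiveM iT h1' h2).
apply: is_primitive0_cst.
apply: eq_is_primitive (is_primitiveD d1 d2) => // x _ /=; ring.
Qed.

Lemma schrodinger_pair_comb q E I (al be : R) u1 v1 u2 v2 :
  is_interval I ->
  schrodinger_pair q E I u1 v1 -> schrodinger_pair q E I u2 v2 ->
  schrodinger_pair q E I (fun x => al * u1 x + be * u2 x)
                         (fun x => al * v1 x + be * v2 x).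
Proof.
move=> iI [h1 h1'] [h2 h2']; split.
  exact: is_primitiveD (is_primitiveZ al h1) (is_primitiveZ be h2).
apply: eq_is_primitive (is_primitiveD (is_primitiveZ al h1') (is_primitiveZ be h2')) => //.
by move=> x _ /=; ring.
Qed.

(** The Wronskians of u with the two fundamental solutions vanish at x0, hence everywhere, and the
    fundamental matrix has determinant 1; so u is 0 by Cramer's rule, with no Gronwall estimate. *)
Lemma schrodinger_pair_unique q E (Phi : R -> 'M[R]_2) u v x0 :
  fundamental_matrix q E Phi -> schrodinger_pair q E setT u v ->
  u x0 = 0 -> v x0 = 0 -> forall x, u x = 0.
Proof.
move=> [Phi0 hPhi] huv u0 v0 x.
have w0 j : u x * Phi x 1 j - v x * Phi x 0 j = 0.
  by rewrite (wronskian_cst huv (hPhi j) x x0) u0 v0 !mul0r subrr.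
have : Phi x 0 0 * Phi x 1 1 - Phi x 1 0 * Phi x 0 1 = 1.
  by rewrite (wronskian_cst (hPhi 0) (hPhi 1) x 0) Phi0 !mxE/= mulr1 mul0r subr0.
have := w0 0; have := w0 1; move: (Phi x 0 0) (Phi x 0 1) (Phi x 1 0) (Phi x 1 1).
move=> p r s t e1 e2 e3.
have -> : u x = u x * (p * t - s * r) by rewrite e3 mulr1.
have -> : u x * (p * t - s * r) = p * (u x * t - v x * r) - r * (u x * s - v x * p).
  by ring.
by rewrite e1 e2 !mulr0 subrr.
Qed.

Lemma open_bands_stability (V0 : R -> R) : open_bands V0 `<=` stability_set V0.
Proof.
move=> E [[c d] /= [E' _ cd] Ecd]; have : `]c, d[%classic E := Ecd; rewrite cd.
exact: connected_component_sub.
Qed.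

(* a + i b is a Floquet solution with multiplier exp(i kappa). *)
Definition floquet_basis (V0 : R -> R) E kappa (a b a' b' : R -> R) (W : R) :=
  [/\ schrodinger_pair V0 E setT a a', schrodinger_pair V0 E setT b b',
      (forall x, a (x + 1) = cos kappa * a x - sin kappa * b x),
      (forall x, b (x + 1) = sin kappa * a x + cos kappa * b x) &
      W != 0 /\ forall x, a x * b' x - a' x * b x = W].

Lemma sqr_sum_eq0 (x y : R) : x ^+ 2 + y ^+ 2 = 0 -> x = 0 /\ y = 0.
Proof.
move=> /eqP; rewrite paddr_eq0 ?sqr_ge0// !sqrf_eq0 => /andP[/eqP -> /eqP ->].
by [].
Qed.

Lemma sqr_le_norm (x c : R) : 0 <= c -> (x ^+ 2 <= c ^+ 2) = (`|x| <= c).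
Proof. by move=> c0; rewrite -(real_normK (num_real x)) ler_sqr. Qed.

Lemma exists_floquet_basis (V0 k : R -> R) E : quasimomentum V0 k ->
  open_bands V0 E -> exists a b a' b' W, floquet_basis V0 E (k E) a b a' b' W.
Proof.
move=> kq EB; have [/andP[k0 kpi] [phi [p [[[a' ha] [b' hb]] [x0 phi0] phip pper]]]] := kq E EB.
have [M [Phi hPhi _] _] := open_bands_stability EB.
set a := fun x => complex.Re (phi x) in ha; set b := fun x => complex.Im (phi x) in hb.
set kp := k E in k0 kpi phip *.
have rot x : phi (x + 1) = phi x * cexp_i kp.
  rewrite !phip pper -mulrA; congr (_ * _).
  by rewrite /cexp_i mulrDr mulr1 cosD sinD; simpc; congr Complex; ring.
have ra x : a (x + 1) = cos kp * a x - sin kp * b x.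
  rewrite /a /b rot; case: (phi x) => u v; rewrite /cexp_i; simpc => /=; ring.
have rb x : b (x + 1) = sin kp * a x + cos kp * b x.
  rewrite /a /b rot; case: (phi x) => u v; rewrite /cexp_i; simpc => /=; ring.
have ab0 : a x0 ^+ 2 + b x0 ^+ 2 != 0.
  apply: contra phi0 => /eqP /sqr_sum_eq0[]; rewrite /a /b.
  by case: (phi x0) => u v /= -> ->.
have Wc := wronskian_cst ha hb.
exists a, b, a', b', (a x0 * b' x0 - a' x0 * b x0); split => //; split; last first.
  by move=> x; exact: Wc.
(* If W were 0, the combination b(x0) a - a(x0) b would have zero Cauchy data at x0 and so vanish
   identically. By the rotation law its value at x0 + 1 is - sin(kp) (a(x0)^2 + b(x0)^2), and
   sin(kp) > 0. *)
apply: contraNneq ab0 => W0.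
have hw := schrodinger_pair_comb (b x0) (- a x0) (fun x y z _ _ _ => I) ha hb.
have w0 : b x0 * a x0 + - a x0 * b x0 = 0 by ring.
have w0' : b x0 * a' x0 + - a x0 * b' x0 = 0.
  by move: W0; move: (a x0) (b x0) (a' x0) (b' x0) => ? ? ? ?; lra.
have := schrodinger_pair_unique hPhi hw w0 w0' (x0 + 1).
rewrite ra rb => h; have : sin kp * (a x0 ^+ 2 + b x0 ^+ 2) = 0 by nra.
have sk : sin kp != 0 by rewrite gt_eqF// sin_gt0_pi// k0.
by move=> /eqP; rewrite mulf_eq0 (negbTE sk)/=.
Qed.

Section basis.
Variables (V0 : R -> R) (E kappa : R) (a b a' b' : R -> R) (W : R).
Hypothesis fb : floquet_basis V0 E kappa a b a' b' W.

Lemma floquet_continuous :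
  [/\ continuous a, continuous b, continuous a' & continuous b'].
Proof.
by case: fb => -[ha ha'] [hb hb'] _ _ _; split; apply: is_primitiveT_continuous;
  eassumption.
Qed.

Lemma floquet_rotation n x :
  a (x + n%:R) = cos (kappa * n%:R) * a x - sin (kappa * n%:R) * b x /\
  b (x + n%:R) = sin (kappa * n%:R) * a x + cos (kappa * n%:R) * b x.
Proof.
case: fb => _ _ ra rb _.
elim: n => [|n [IHa IHb]]; first by rewrite mulr0 addr0 cos0 sin0; split; ring.
rewrite -natr1 addrA ra rb IHa IHb (mulrDr kappa) mulr1 cosD sinD; split; ring.
Qed.

Lemma floquet_norm_periodic n x :
  a (x + n%:R) ^+ 2 + b (x + n%:R) ^+ 2 = a x ^+ 2 + b x ^+ 2.
Proof.
have [-> ->] := floquet_rotation n x.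
have := cos2Dsin2 (kappa * n%:R).
move: (cos _) (sin _) => c s cs.
rewrite (_ : _ + _ = (c ^+ 2 + s ^+ 2) * (a x ^+ 2 + b x ^+ 2)); last by ring.
by rewrite cs mul1r.
Qed.

Lemma floquet_bounded : exists C, 0 <= C /\ forall x, 0 <= x ->
  `|a x| <= C /\ `|b x| <= C.
Proof.
have [ca cb _ _] := floquet_continuous.
have [A A0 aA] := continuous_bounded_itv 0 1 ca.
have [B B0 bB] := continuous_bounded_itv 0 1 cb.
exists (A + B); split => [|x x0]; first by rewrite ltW// addr_gt0.
have /andP[nx xn] := truncn_itv x0.
set n := Num.truncn x in nx xn; pose y := x - n%:R.
have y01 : 0 <= y <= 1 by rewrite /y; move: xn; rewrite -natr1; lra.
have := floquet_norm_periodic n y; rewrite /y subrK.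
have := aA _ y01; have := bB _ y01; rewrite -/y.
have AB := mulr_gt0 A0 B0.
have AB0 := addr_gt0 A0 B0.
rewrite -!sqr_le_norm ?(ltW A0) ?(ltW B0) ?(ltW AB0)// => hb ha hn.
rewrite (_ : (A + B) ^+ 2 = A ^+ 2 + B ^+ 2 + 2 * (A * B)); last by ring.
have := sqr_ge0 (a x); have := sqr_ge0 (b x); split; lra.
Qed.

Lemma floquet_neq0 x : 0 < a x ^+ 2 + b x ^+ 2.
Proof.
rewrite lt_def addr_ge0 ?sqr_ge0// andbT; apply/eqP => /sqr_sum_eq0[ax bx].
case: fb => _ _ _ _ [/eqP W0 /(_ x)].
by rewrite ax bx mul0r mulr0 subrr => /esym.
Qed.

End basis.

End floquet.

(** * Variation of parameters *)

Section perturbed_state.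
Context {R : realType}.
Notation mu := (@lebesgue_measure R).
Variables (a b V : R -> R) (W : R).
Hypotheses (ca : continuous a) (cb : continuous b) (cV : continuous V).

(** The system for z1' and z2' in integral form. Continuity is required on the whole line, the
    equations only on the half-line, in accordance with [int0]. *)
Definition state_equation (z1 z2 : R -> R) :=
  [/\ continuous z1, continuous z2,
      (forall x, 0 <= x -> z1 x = z1 0 +
        int0 (fun t => - (V t * b t / W) * (z1 t * a t + z2 t * b t)) x) &
      (forall x, 0 <= x -> z2 x = z2 0 +
        int0 (fun t => V t * a t / W * (z1 t * a t + z2 t * b t)) x)].

Variables z1 z2 : R -> R.
Hypothesis zE : state_equation z1 z2.

Let cz1 : continuous z1. Proof. by case: zE. Qed.
Let cz2 : continuous z2. Proof. by case: zE. Qed.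

Lemma state_continuous_integrands :
  continuous (fun t => - (V t * b t / W) * (z1 t * a t + z2 t * b t)) /\
  continuous (fun t => V t * a t / W * (z1 t * a t + z2 t * b t)).
Proof.
have cu : continuous (fun t => z1 t * a t + z2 t * b t).
  by move=> t; apply: cvgD; apply: cvgM; [exact: cz1|exact: ca|exact: cz2|exact: cb].
have cf (c : R -> R) : continuous c -> continuous (fun t => V t * c t / W).
  by move=> cc t; apply: cvgM; [apply: cvgM; [exact: cV|exact: cc]|exact: cvg_cst].
split=> t; apply: cvgM; try exact: cu; last exact: cf ca t.
by apply: cvgN; exact: cf cb t.
Qed.

Lemma int0B (f : R -> R) s t : continuous f -> 0 <= s -> s <= t ->
  int0 f t - int0 f s = \int[mu]_(x in `[s, t]) f x.
Proof.
move=> cf s0 st; rewrite /int0 (Rint_split s0 st); first by rewrite addrAC subrr add0r.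
exact: continuous_integrable_itv.
Qed.

Lemma stateB s t : 0 <= s -> s <= t ->
  z1 t - z1 s =
    \int[mu]_(x in `[s, t]) (- (V x * b x / W) * (z1 x * a x + z2 x * b x)) /\
  z2 t - z2 s =
    \int[mu]_(x in `[s, t]) (V x * a x / W * (z1 x * a x + z2 x * b x)).
Proof.
move=> s0 st; have t0 := le_trans s0 st.
have [c1 c2] := state_continuous_integrands.
case: zE => _ _ e1 e2; rewrite -!int0B//.
by rewrite (e1 t t0) (e1 s s0) (e2 t t0) (e2 s s0); split; ring.
Qed.

Variables (s t C v : R).
Hypotheses (s0 : 0 <= s) (st : s <= t) (C0 : 0 <= C) (v0 : 0 <= v).
Hypothesis abC : forall x, s <= x <= t -> `|a x| <= C /\ `|b x| <= C.
Hypothesis Vv : forall x, s <= x <= t -> `|V x| <= v.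

(** Over [s, t] each of z1, z2 moves by at most [rho] times the maximum of |z1| + |z2| there. *)
Let rho := v * C ^+ 2 / `|W| * (t - s).

Hypothesis rho_small : 2 * rho <= 1 / 2.

Let rho0 : 0 <= rho.
Proof. by rewrite /rho mulr_ge0 ?subr_ge0// divr_ge0// mulr_ge0// exprn_ge0. Qed.

Lemma kernel_bound (c w1 w2 : R) x N : s <= x <= t -> `|c| <= C ->
  `|w1| + `|w2| <= N ->
  `|V x * c / W * (w1 * a x + w2 * b x)| <= v * C ^+ 2 / `|W| * N.
Proof.
move=> xst cC zN; have [aC bC] := abC xst.
rewrite !normrM normfV.
have -> : v * C ^+ 2 / `|W| * N = v * C / `|W| * (C * N) by ring.
apply: ler_pM => //.
  by rewrite ler_wpM2r ?invr_ge0//; apply: ler_pM => //; exact: Vv.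
apply: le_trans (ler_normD _ _) _; rewrite !normrM.
apply: le_trans (ler_wpM2l C0 zN); rewrite mulrDr.
by rewrite lerD// mulrC ler_wpM2r.
Qed.

(** Evaluation at a maximum point replaces Gronwall: the maximum M exceeds the initial value by at
    most 2 rho M <= M / 2. *)
Lemma state_growth x : s <= x <= t ->
  `|z1 x| + `|z2 x| <= 2 * (`|z1 s| + `|z2 s|).
Proof.
have cN : {within `[s, t], continuous (fun x => `|z1 x| + `|z2 x|)}.
  apply: continuous_subspaceT => y.
  by apply: cvgD; apply: cvg_norm; [exact: cz1|exact: cz2].
have [y yst yM] := EVT_max st cN.
set M := `|z1 y| + `|z2 y| in yM.
suff h : M <= 2 * (`|z1 s| + `|z2 s|).
  by move=> xst; apply: le_trans h; apply: yM; rewrite in_itv.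
move: yst; rewrite in_itv/= => /andP[sy yt].
have [e1 e2] := stateB s0 sy.
have [c1 c2] := state_continuous_integrands.
have bnd (f : R -> R) : continuous f ->
   (forall x, s <= x <= t -> `|f x| <= v * C ^+ 2 / `|W| * M) ->
   `|\int[mu]_(x in `[s, y]) f x| <= rho * M.
  move=> cf fM; apply: (@le_trans _ _ (v * C ^+ 2 / `|W| * M * (y - s))).
    apply: Rint_le_cst => //; first exact: continuous_integrable_itv.
    by move=> w /andP[sw wy]; rewrite fM// sw (le_trans wy).
  rewrite /rho mulrAC ler_wpM2r ?addr_ge0// ler_wpM2l ?lerD2r//.
  by rewrite divr_ge0// mulr_ge0// exprn_ge0.
have h1 : `|z1 y - z1 s| <= rho * M.
  rewrite e1; apply: bnd => // w wst; have [_ bC] := abC wst.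
  rewrite mulNr normrN; apply: kernel_bound => //.
  by apply: yM; rewrite in_itv.
have h2 : `|z2 y - z2 s| <= rho * M.
  rewrite e2; apply: bnd => // w wst; have [aC _] := abC wst.
  apply: kernel_bound => //.
  by apply: yM; rewrite in_itv.
have := ler_normD (z1 y - z1 s) (z1 s); have := ler_normD (z2 y - z2 s) (z2 s).
rewrite !subrK => g2 g1.
have : M <= `|z1 s| + `|z2 s| + 2 * rho * M by rewrite {1}/M; lra.
have : 2 * rho * M <= 1 / 2 * M by rewrite ler_wpM2r// /M addr_ge0.
by lra.
Qed.

Lemma state_increment (c : R -> R) : continuous c ->
  (forall x, s <= x <= t -> `|c x| <= C) ->
  forall x, s <= x <= t ->
  `|\int[mu]_(y in `[s, x]) (V y * c y / W * (z1 y * a y + z2 y * b y))| <=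
  2 * rho * (`|z1 s| + `|z2 s|).
Proof.
move=> cc cC x /andP[sx xt].
set N := `|z1 s| + `|z2 s|.
have N0 : 0 <= N by rewrite addr_ge0.
have cf : continuous (fun y => V y * c y / W * (z1 y * a y + z2 y * b y)).
  move=> y; apply: cvgM.
    by apply: cvgM; [apply: cvgM; [exact: cV|exact: cc]|exact: cvg_cst].
  by apply: cvgD; apply: cvgM; first [exact: ca|exact: cb|exact: cz1|exact: cz2].
apply: (@le_trans _ _ (v * C ^+ 2 / `|W| * (2 * N) * (x - s))).
  apply: Rint_le_cst => //; first exact: continuous_integrable_itv.
  move=> y /andP[sy yx]; have yst : s <= y <= t by rewrite sy (le_trans yx).
  apply: kernel_bound => //; first exact: cC.
  exact: state_growth.
rewrite (_ : 2 * rho * N = v * C ^+ 2 / `|W| * (2 * N) * (t - s)); last first.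
  by rewrite /rho; ring.
rewrite ler_wpM2l ?lerD2r// mulr_ge0 ?mulr_ge0// divr_ge0// mulr_ge0// exprn_ge0.
Qed.

(** Freezing the state at s changes each coordinate by at most 2 rho N, hence their sum by 4 rho N;
    integration against the kernel contributes one more factor rho. *)
Lemma state_second_order (c : R -> R) : continuous c ->
  (forall x, s <= x <= t -> `|c x| <= C) ->
  `|\int[mu]_(y in `[s, t]) (V y * c y / W * (z1 y * a y + z2 y * b y)) -
    \int[mu]_(y in `[s, t]) (V y * c y / W * (z1 s * a y + z2 s * b y))| <=
  4 * rho ^+ 2 * (`|z1 s| + `|z2 s|).
Proof.
move=> cc cC; set N := `|z1 s| + `|z2 s|.
have N0 : 0 <= N by rewrite addr_ge0.
have cVc : continuous (fun y => V y * c y / W).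
  by move=> y; apply: cvgM; [apply: cvgM; [exact: cV|exact: cc]|exact: cvg_cst].
have cf (w1 w2 : R -> R) : continuous w1 -> continuous w2 ->
    continuous (fun y => V y * c y / W * (w1 y * a y + w2 y * b y)).
  move=> cw1 cw2 y; apply: cvgM; first exact: cVc.
  by apply: cvgD; apply: cvgM; first [exact: ca|exact: cb|exact: cw1|exact: cw2].
have cs1 : continuous (fun _ : R => z1 s) by exact: cst_continuous.
have cs2 : continuous (fun _ : R => z2 s) by exact: cst_continuous.
rewrite -RintegralB//; last 2 first.
  by apply: continuous_integrable_itv; exact: cf.
  by apply: continuous_integrable_itv; exact: (cf _ _ cs1 cs2).
apply: (@le_trans _ _ (v * C ^+ 2 / `|W| * (4 * rho * N) * (t - s))); last first.
  by rewrite /rho le_eqVlt; apply/orP; left; apply/eqP; ring.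
apply: Rint_le_cst => //.
  apply: integrableB_EFin => //; apply: continuous_integrable_itv;
    [exact: cf|exact: (cf _ _ cs1 cs2)].
move=> x xst; rewrite -mulrBr (_ : _ - _ = (z1 x - z1 s) * a x + (z2 x - z2 s) * b x);
  last by ring.
apply: kernel_bound => //; first exact: cC.
case/andP: (xst) => sx _; have [-> ->] := stateB s0 sx.
have -> : 4 * rho * N = 2 * rho * N + 2 * rho * N by ring.
apply: lerD; last by apply: state_increment => // y /abC[].
rewrite (_ : \int[mu]_(y in `[s, x]) _ = \int[mu]_(y in `[s, x])
    (V y * (- b y) / W * (z1 y * a y + z2 y * b y))); last first.
  by apply: eq_Rintegral => y _ /=; ring.
apply: state_increment => // [y|y /abC[_]]; last by rewrite normrN.
by apply: cvgN; exact: cb.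
Qed.

Lemma state_block_estimate :
  z1 t ^+ 2 + z2 t ^+ 2 <= z1 s ^+ 2 + z2 s ^+ 2 +
    W^-1 * \int[mu]_(x in `[s, t]) (V x *
      ((a x ^+ 2 - b x ^+ 2) * (2 * z1 s * z2 s) -
       (2 * a x * b x) * (z1 s ^+ 2 - z2 s ^+ 2))) +
    32 * rho ^+ 2 * (z1 s ^+ 2 + z2 s ^+ 2).
Proof.
set N := `|z1 s| + `|z2 s|.
have N0 : 0 <= N by rewrite addr_ge0.
have [e1 e2] := stateB s0 st.
have cNb : continuous (fun y => - b y) by move=> y; apply: cvgN; exact: cb.
have NbC x : s <= x <= t -> `|- b x| <= C by rewrite normrN => /abC[].
have aC x : s <= x <= t -> `|a x| <= C by move=> /abC[].
have stt : s <= t <= t by rewrite st lexx.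
have {}e1 : z1 t - z1 s = \int[mu]_(x in `[s, t])
    (V x * (- b x) / W * (z1 x * a x + z2 x * b x)).
  by rewrite e1; apply: eq_Rintegral => y _ /=; ring.
have r1 := state_second_order cNb NbC; have r2 := state_second_order ca aC.
have d1 := state_increment cNb NbC stt; have d2 := state_increment ca aC stt.
rewrite -e1 -/N in r1 d1; rewrite -e2 -/N in r2 d2.
set I1 := (X in `|_ - X|) in r1; set I2 := (X in `|_ - X|) in r2.
have cI (c : R -> R) : continuous c -> mu.-integrable `[s, t]
    (EFin \o (fun y => V y * c y / W * (z1 s * a y + z2 s * b y))).
  move=> cc; apply: continuous_integrable_itv => y; apply: cvgM.
    by apply: cvgM; [apply: cvgM; [exact: cV|exact: cc]|exact: cvg_cst].
  by apply: cvgD; apply: cvgM; first [exact: ca|exact: cb|exact: cvg_cst].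
have -> : W^-1 * \int[mu]_(x in `[s, t]) (V x *
      ((a x ^+ 2 - b x ^+ 2) * (2 * z1 s * z2 s) -
       (2 * a x * b x) * (z1 s ^+ 2 - z2 s ^+ 2))) = 2 * z1 s * I1 + 2 * z2 s * I2.
  rewrite /I1 /I2 -!RintegralZl//; last 3 first.
  - apply: continuous_integrable_itv => y; apply: cvgM; first exact: cV.
    apply: cvgB; apply: cvgM; try exact: cvg_cst.
      apply: cvgB; apply: (@cvg_comp _ _ _ _ (fun x : R => x ^+ 2));
        try exact: exprn_continuous; [exact: ca|exact: cb].
    by apply: cvgM; [apply: cvgM; [exact: cvg_cst|exact: ca]|exact: cb].
  - exact: cI.
  - exact: cI.
  rewrite -RintegralD//; last 2 first.
  - by apply: integrableZl_EFin => //; exact: cI.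
  - by apply: integrableZl_EFin => //; exact: cI.
  by apply: eq_Rintegral => x _; ring.
have expand (x y J : R) : `|y - x| <= 2 * rho * N -> `|y - x - J| <= 4 * rho ^+ 2 * N ->
    y ^+ 2 <= x ^+ 2 + 2 * x * J + 2 * `|x| * (4 * rho ^+ 2 * N) + 4 * rho ^+ 2 * N ^+ 2.
  move=> h1 h2.
  have -> : y ^+ 2 = x ^+ 2 + 2 * x * J + 2 * (x * (y - x - J)) + (y - x) ^+ 2 by ring.
  have : (y - x) ^+ 2 <= (2 * rho * N) ^+ 2.
    by rewrite sqr_le_norm// mulr_ge0// mulr_ge0.
  have := ler_norm (x * (y - x - J)); rewrite normrM.
  have := ler_wpM2l (normr_ge0 x) h2.
  by rewrite (_ : (2 * rho * N) ^+ 2 = 4 * rho ^+ 2 * N ^+ 2); [lra|ring].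
have x1 := expand _ _ _ d1 r1; have x2 := expand _ _ _ d2 r2.
have NN : N ^+ 2 <= 2 * (z1 s ^+ 2 + z2 s ^+ 2).
  rewrite -(real_normK (num_real (z1 s))) -(real_normK (num_real (z2 s))) /N.
  have := sqr_ge0 (`|z1 s| - `|z2 s|); move: `|_| `|_| => p q; nra.
have := ler_wpM2l (sqr_ge0 rho) NN.
have : 2 * `|z1 s| * (4 * rho ^+ 2 * N) + 2 * `|z2 s| * (4 * rho ^+ 2 * N) =
  8 * (rho ^+ 2 * N ^+ 2) by rewrite /N; ring.
move: x1 x2; rewrite -!mulrA; lra.
Qed.

End perturbed_state.

(** * Sums of translated bumps *)

Section potential.
Context {R : realType}.
Notation mu := (@lebesgue_measure R).
Variable eta : nat -> R -> R.
Hypothesis eta_smooth : forall i, smooth (eta i).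
Hypothesis eta01 : forall i x, 0 <= eta i x <= 1.
Hypothesis eta_out : forall i x, ~~ (0 < x < 1) -> eta i x = 0.
Implicit Types c : nat -> nat -> R.

(** Truncating at i < n keeps every cell a finite sum. Nothing is lost as long as cell n uses at
    most n energies, which [stage_le] will guarantee. *)
Definition cell c n x : R := \sum_(i < n) c n i * eta i (x - n%:R).

(** Bumps vanish at the ends of their cells, so the choice of cell at an integer does not matter;
    for negative x the truncation is 0 and cell 0 is an empty sum. *)
Definition potential c x := cell c (Num.truncn x) x.

Lemma cell_out c n x : ~~ (n%:R < x < n.+1%:R) -> cell c n x = 0.
Proof.
move=> h; apply: big1 => i _; rewrite eta_out ?mulr0//.
apply: contra h => /andP[h1 h2]; rewrite -natr1; apply/andP; split; lra.
Qed.

Lemma potential_cell c n x : n%:R <= x <= n.+1%:R -> potential c x = cell c n x.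
Proof.
move=> /andP[nx]; rewrite le_eqVlt => /predU1P[xn|xn]; last first.
  by rewrite /potential (@truncn_def _ _ n)// nx.
rewrite /potential xn natrK !cell_out ?ltxx ?andbF//.
Qed.

Lemma potential_sum c M x : x < M%:R -> potential c x = \sum_(n < M) cell c n x.
Proof.
move=> xM; have [x0|x0] := ltP x 0.
  rewrite /potential (_ : Num.truncn x = 0%N); last first.
    by apply/eqP; rewrite -leqn0 truncn_le_nat (lt_le_trans x0).
  rewrite /cell big_ord0 big1// => n _; apply: cell_out.
  by rewrite negb_and -leNgt (le_trans (ltW x0)).
have tM : (Num.truncn x < M)%N by rewrite truncn_lt_nat.
rewrite (bigD1 (Ordinal tM))//= big1 ?addr0// => n nt.
apply: cell_out; apply: contra nt => /andP[nx xn].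
by apply/eqP/val_inj => /=; apply/esym/truncn_def; rewrite (ltW nx).
Qed.

Lemma smooth_cell c n : smooth (cell c n).
Proof.
apply: (@smooth_sum _ _ _ (fun (i : 'I_n) x => c n i * eta i (x - n%:R))) => i.
apply: smoothM; first exact: smooth_cst.
rewrite (_ : (fun x => _) = (fun x => eta i (1 * x - n%:R))).
  exact: smooth_affine.
by apply/funext => x; rewrite mul1r.
Qed.

Lemma smooth_potential c : smooth (potential c).
Proof.
apply: near_eq_smooth => x; have [M xM] : exists M, x < M%:R.
  by exists (Num.truncn x).+1; exact: truncnS_gt.
exists (fun x => \sum_(n < M) cell c n x).
  by apply: (@smooth_sum _ _ _ (fun (n : 'I_M) x => cell c n x)) => n; exact: smooth_cell.
by near=> y; apply: potential_sum; near: y; exact: lt_nbhsl.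
Unshelve. all: by end_near. Qed.

Lemma continuous_potential c : continuous (potential c).
Proof. exact: (@smooth_continuous _ _ 0 (@smooth_potential c)). Qed.

Lemma potential_bound c n x : n%:R <= x <= n.+1%:R ->
  `|potential c x| <= \sum_(i < n) `|c n i|.
Proof.
move=> nx; rewrite (potential_cell _ nx); apply: le_trans (ler_norm_sum _ _ _) _.
apply: ler_sum => i _; rewrite normrM ler_piMr//.
by have /andP[e0 e1] := eta01 i (x - n%:R); rewrite ger0_norm.
Qed.

Lemma potential_local c c' M x : (forall n i, (n < M)%N -> c n i = c' n i) ->
  x <= M%:R -> potential c x = potential c' x.
Proof.
move=> cc; rewrite le_eqVlt => /predU1P[->|xM].
  by rewrite /potential natrK !cell_out ?ltxx.
rewrite !(potential_sum _ xM); apply: eq_bigr => n _.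
by apply: eq_bigr => i _; rewrite cc.
Qed.

Lemma Rint_shift (f : R -> R) (n : nat) : continuous f ->
  \int[mu]_(x in `[n%:R, n.+1%:R]) f x = \int[mu]_(x in `[0, 1]) f (x + n%:R).
Proof.
move=> cf; pose F (x : R) := x + n%:R.
have dF x : is_derive x (1 : R) F 1.
  have := @is_derive_affine R 1 n%:R x; rewrite (_ : (fun t => _) = F)//.
  by apply/funext => y; rewrite /F mul1r.
have [DF F1] := is_deriveP_R dF.
rewrite /Rintegral; congr fine.
have -> : `[n%:R, n.+1%:R]%classic = `[F 0, F 1]%classic.
  by rewrite /F add0r addrC natr1.
rewrite integration_by_substitution_increasing//.
- apply: eq_integral => x _; rewrite F1; congr EFin; exact: mulr1.
- by move=> x y _ _ xy; rewrite /F ltrD2r.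
- by rewrite F1 => x _; exact: cvg_cst.
- by rewrite F1; apply: is_cvg_cst.
- by rewrite F1; apply: is_cvg_cst.
- have cF := derivable_continuous DF.
  by split => [x _||]; [exact: DF|apply: cvg_at_right_filter; exact: cF|
    apply: cvg_at_left_filter; exact: cF].
- exact: continuous_subspaceT.
Qed.

Lemma Rint_cells (f : R -> R) (n0 N : nat) : continuous f ->
  \int[mu]_(x in `[n0%:R, (n0 + N)%:R]) f x =
  \sum_(m < N) \int[mu]_(x in `[(n0 + m)%:R, (n0 + m).+1%:R]) f x.
Proof.
move=> cf; elim: N => [|N IH].
  by rewrite addn0 set_itv1 Rintegral_set1 big_ord0.
rewrite big_ord_recr/= -IH addnS; apply: Rint_split; rewrite ?ler_nat ?leq_addr//.
exact: continuous_integrable_itv.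
Qed.

Lemma Rint_potential c (f : R -> R) n : continuous f ->
  \int[mu]_(x in `[n%:R, n.+1%:R]) (potential c x * f x) =
  \sum_(i < n) c n i * \int[mu]_(x in `[0, 1]) (eta i x * f (x + n%:R)).
Proof.
move=> cf.
have ceta i : continuous (eta i) := @smooth_continuous _ _ 0 (@eta_smooth i).
rewrite Rint_shift; last first.
  by move=> x; apply: cvgM; [exact: continuous_potential|exact: cf].
have cfn : continuous (fun x : R => f (x + n%:R)).
  move=> x; apply: continuous_comp; last exact: cf.
  by apply: cvgD; [exact: cvg_id|exact: cvg_cst].
have ce i : continuous (fun x : R => eta i x * f (x + n%:R)).
  by move=> x; apply: cvgM; [exact: ceta|exact: cfn].
rewrite (_ : \int[mu]_(x in _) _ =
    \int[mu]_(x in `[0, 1]) \sum_(i < n) c n i * (eta i x * f (x + n%:R))); last first.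
  apply: eq_Rintegral => x; rewrite inE/= in_itv/= => x01.
  rewrite (@potential_cell c n); last by rewrite -natr1; lra.
  by rewrite /cell mulr_suml; apply: eq_bigr => i _; rewrite addrK mulrA.
(* Integrability and value are proved together, since linearity at each step needs the integrability
   of the tail. *)
have H (r : seq 'I_n) : mu.-integrable `[0, 1] (EFin \o (fun x : R =>
      \sum_(i <- r) c n i * (eta i x * f (x + n%:R)))) /\
    \int[mu]_(x in `[0, 1]) \sum_(i <- r) c n i * (eta i x * f (x + n%:R)) =
    \sum_(i <- r) c n i * \int[mu]_(x in `[0, 1]) (eta i x * f (x + n%:R)).
  elim: r => [|i r [i1 i2]].
    split; last by under eq_Rintegral do rewrite big_nil;
      rewrite big_nil Rintegral_cst// mul0r.
    rewrite (_ : (fun x => _) = (fun=> 0)); last by apply/funext => x; rewrite big_nil.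
    by apply: continuous_integrable_itv; exact: cst_continuous.
  have ii : mu.-integrable `[0, 1] (EFin \o (fun x => eta i x * f (x + n%:R))).
    by apply: continuous_integrable_itv; exact: ce.
  rewrite (_ : (fun x => _) = (fun x => c n i * (eta i x * f (x + n%:R)) +
      \sum_(j <- r) c n j * (eta j x * f (x + n%:R)))); last first.
    by apply/funext => x; rewrite big_cons.
  split; first by apply: integrableD_EFin => //; exact: integrableZl_EFin.
  rewrite RintegralD//; last exact: integrableZl_EFin.
  by rewrite RintegralZl// i2 big_cons.
exact: (H _).2.
Qed.

End potential.

(** * Averages of oscillating products *)

Section resonance.
Context {R : realType}.
Notation mu := (@lebesgue_measure R).
Implicit Types (theta kappa P Q : R) (n N : nat).

Lemma sum_telescope (f : nat -> R) n N :
  \sum_(m < N) (f (n + m).+1 - f (n + m)%N) = f (n + N)%N - f n.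
Proof.
elim: N => [|N IH]; first by rewrite big_ord0 addn0 subrr.
by rewrite big_ord_recr/= IH addnS; ring.
Qed.

(* 2 sin(theta/2) cos(theta m) = sin(theta(m+1/2)) - sin(theta(m-1/2)), and
   similarly for the sine, so both sums telescope. *)
Lemma trig_sum_bound theta n N : sin (theta / 2) != 0 ->
  `|\sum_(m < N) cos (theta * (n + m)%:R)| <= `|sin (theta / 2)|^-1 /\
  `|\sum_(m < N) sin (theta * (n + m)%:R)| <= `|sin (theta / 2)|^-1.
Proof.
move=> s0; pose h m := theta * m%:R - theta / 2.
have hS m : h m.+1 = theta * m%:R + theta / 2.
  by rewrite /h -natr1 mulrDr mulr1; field.
have bnd (S u v : R) : 2 * sin (theta / 2) * S = u - v -> `|u| <= 1 -> `|v| <= 1 ->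
    `|S| <= `|sin (theta / 2)|^-1.
  move=> e u1 v1; rewrite -[leRHS]mul1r ler_pdivlMr ?normr_gt0// -normrM mulrC.
  have -> : sin (theta / 2) * S = (u - v) / 2 by rewrite -e; field.
  by move: u1 v1; rewrite !ler_norml; lra.
have cosB1 x : `|cos x| <= 1 :> R by rewrite ler_norml cos_geN1 cos_le1.
have sinB1 x : `|sin x| <= 1 :> R by rewrite ler_norml sin_geN1 sin_le1.
split.
  apply: (bnd _ (sin (h (n + N)%N)) (sin (h n))) => //.
  rewrite -(sum_telescope (sin \o h)) mulr_sumr; apply: eq_bigr => m _ /=.
  by rewrite hS /h sinD sinB; ring.
apply: (bnd _ (- cos (h (n + N)%N)) (- cos (h n))); rewrite ?normrN//.
rewrite -(sum_telescope (fun m => - cos (h m))) mulr_sumr; apply: eq_bigr => m _ /=.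
by rewrite hS /h cosD cosB; ring.
Qed.

(** The frequency is 2 kappa because the energy change involves the square of the Floquet
    solution. *)
Definition wave kappa P Q n : R :=
  P * cos (2 * kappa * n%:R) + Q * sin (2 * kappa * n%:R).

(** The square is its mean (P^2 + Q^2)/2 plus waves of frequency 4 kappa with coefficients (P^2 -
    Q^2)/2 and PQ. Both coefficients are at most the mean in size, and the sums of those waves stay
    bounded in N. *)
Lemma wave_sqr_sum kappa n N P Q : sin (2 * kappa) != 0 ->
  (P ^+ 2 + Q ^+ 2) * (N%:R / 2 - `|sin (2 * kappa)|^-1) <=
  \sum_(m < N) wave kappa P Q (n + m) ^+ 2.
Proof.
move=> s0; set G := `|_|^-1.
have e4 : 4 * kappa / 2 = 2 * kappa by field.
have [] := @trig_sum_bound (4 * kappa) n N; first by rewrite e4.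
rewrite e4 -/G; set c := \sum_(_ < _) _; set s := \sum_(_ < _) _ => hc hs.
have -> : \sum_(m < N) wave kappa P Q (n + m) ^+ 2 =
    (P ^+ 2 + Q ^+ 2) / 2 * N%:R + (P ^+ 2 - Q ^+ 2) / 2 * c + P * Q * s.
  have -> : (P ^+ 2 + Q ^+ 2) / 2 * N%:R = \sum_(m < N) (P ^+ 2 + Q ^+ 2) / 2.
    by rewrite sumr_const card_ord mulr_natr.
  rewrite /c /s !mulr_sumr -!big_split/=.
  apply: eq_bigr => m _; rewrite /wave.
  have -> : 4 * kappa * (n + m)%:R = 2 * kappa * (n + m)%:R + 2 * kappa * (n + m)%:R.
    by ring.
  rewrite cosD sinD; have := cos2Dsin2 (2 * kappa * (n + m)%:R).
  move: (cos _) (sin _) => x y xy.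
  have -> : P ^+ 2 + Q ^+ 2 = (P ^+ 2 + Q ^+ 2) * (x ^+ 2 + y ^+ 2) by rewrite xy mulr1.
  by field.
have hP : `|(P ^+ 2 - Q ^+ 2) / 2 * c| <= (P ^+ 2 + Q ^+ 2) / 2 * G.
  rewrite normrM; apply: ler_pM => //.
  by rewrite ler_norml; have := sqr_ge0 P; have := sqr_ge0 Q; lra.
have hQ : `|P * Q * s| <= (P ^+ 2 + Q ^+ 2) / 2 * G.
  rewrite normrM; apply: ler_pM => //.
  by rewrite ler_norml; have := sqr_ge0 (P + Q); have := sqr_ge0 (P - Q); nra.
move: hP hQ; rewrite !ler_norml => /andP[+ _] /andP[+ _].
lra.
Qed.

(** A product of two waves has only the frequencies 2(k1 - k2) and 2(k1 + k2), so it has no mean and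
    its sums are bounded uniformly in N. *)
Lemma wave_mul_sum k1 k2 n N P1 Q1 P2 Q2 :
  sin (k1 - k2) != 0 -> sin (k1 + k2) != 0 ->
  `|\sum_(m < N) wave k1 P1 Q1 (n + m) * wave k2 P2 Q2 (n + m)| <=
  (`|sin (k1 - k2)|^-1 + `|sin (k1 + k2)|^-1) *
  ((`|P1| + `|Q1|) * (`|P2| + `|Q2|)).
Proof.
move=> sm sp; set Gm := `|_|^-1; set Gp := `|sin (k1 + k2)|^-1.
have em : 2 * (k1 - k2) / 2 = k1 - k2 by field.
have ep : 2 * (k1 + k2) / 2 = k1 + k2 by field.
have [] := @trig_sum_bound (2 * (k1 - k2)) n N; first by rewrite em.
have [] := @trig_sum_bound (2 * (k1 + k2)) n N; first by rewrite ep.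
rewrite em ep -/Gm -/Gp.
set cp := \sum_(_ < _) _; set sp' := \sum_(_ < _) _ => hcp hsp.
set cm := \sum_(_ < _) _; set sm' := \sum_(_ < _) _ => hcm hsm.
have -> : \sum_(m < N) wave k1 P1 Q1 (n + m) * wave k2 P2 Q2 (n + m) =
    P1 * P2 * ((cm + cp) / 2) + Q1 * Q2 * ((cm - cp) / 2) +
    Q1 * P2 * ((sp' + sm') / 2) + P1 * Q2 * ((sp' - sm') / 2).
  rewrite /cp /sp' /cm /sm' -sumrB -big_split/= -big_split/= -sumrB.
  rewrite !mulr_suml !mulr_sumr -!big_split/=.
  apply: eq_bigr => m _; rewrite /wave.
  have -> : 2 * (k1 + k2) * (n + m)%:R = 2 * k1 * (n + m)%:R + 2 * k2 * (n + m)%:R.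
    by ring.
  have -> : 2 * (k1 - k2) * (n + m)%:R = 2 * k1 * (n + m)%:R - 2 * k2 * (n + m)%:R.
    by ring.
  move: (2 * k1 * _) (2 * k2 * _) => x y.
  rewrite (cosD x y) (sinD x y) (cosB x y) (sinB x y); by field.
set G := Gm + Gp.
have half (x y : R) : `|x| <= Gm -> `|y| <= Gp -> `|(x + y) / 2| <= G /\ `|(x - y) / 2| <= G.
  rewrite /G !ler_norml; lra.
have [h1 h2] := half _ _ hcm hcp; have [h3 h4] := half _ _ hsm hsp.
have {}h4 : `|(sp' - sm') / 2| <= G.
  by rewrite -normrN -mulNr opprB.
rewrite addrC in h3.
have t (x y z : R) : `|z| <= G -> `|x * y * z| <= `|x| * `|y| * G.
  by move=> zG; rewrite !normrM ler_wpM2l// mulr_ge0.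
have := t P1 P2 _ h1; have := t Q1 Q2 _ h2; have := t Q1 P2 _ h3; have := t P1 Q2 _ h4.
move: (P1 * Q2 * _) (Q1 * P2 * _) (Q1 * Q2 * _) (P1 * P2 * _) => y1 y2 y3 y4 g1 g2 g3 g4.
have -> : G * ((`|P1| + `|Q1|) * (`|P2| + `|Q2|)) =
  `|P1| * `|P2| * G + `|Q1| * `|Q2| * G + `|Q1| * `|P2| * G + `|P1| * `|Q2| * G by ring.
by do 3?[apply: le_trans (ler_normD _ _) _; apply: lerD => //].
Qed.

End resonance.

(** * Bumps resonating with a Floquet solution *)

Section resonant_bump.
Context {R : realType}.
Notation mu := (@lebesgue_measure R).

Lemma Rint_gt0 (f : R -> R) (a b c : R) : continuous f -> a < c -> c < b ->
  (forall x, a <= x <= b -> 0 <= f x) -> 0 < f c ->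
  0 < \int[mu]_(x in `[a, b]) f x.
Proof.
move=> cf ac cb f0 fc.
have /cvgrPdist_lt /(_ (f c / 2)) := cf c.
rewrite divr_gt0// => /(_ isT) /nbhs_ballP[d /= d0 hd].
pose r := Num.min (d / 2) (Num.min (c - a) (b - c)).
have r0 : 0 < r by rewrite !lt_min divr_gt0// !subr_gt0 ac.
have rd : r <= d / 2 by rewrite /r ge_min lexx.
have ra : r <= c - a by rewrite /r !ge_min lexx orbT.
have rb : r <= b - c by rewrite /r !ge_min lexx !orbT.
have i s t := @continuous_integrable_itv R f s t cf.
have h1 : a <= c - r by lra.
have h2 : c - r <= c + r by lra.
have h3 : c + r <= b by lra.
rewrite (Rint_split h1 (le_trans h2 h3) (i _ _)) (Rint_split h2 h3 (i _ _)).
have p1 : 0 <= \int[mu]_(x in `[a, c - r]) f x.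
  by apply: Rintegral_ge0 => x; rewrite /= in_itv/= => /andP[? ?]; apply: f0; lra.
have p3 : 0 <= \int[mu]_(x in `[c + r, b]) f x.
  by apply: Rintegral_ge0 => x; rewrite /= in_itv/= => /andP[? ?]; apply: f0; lra.
have p2 : f c / 2 * (r + r) <= \int[mu]_(x in `[c - r, c + r]) f x.
  have -> : f c / 2 * (r + r) = \int[mu]_(x in `[c - r, c + r]) (f c / 2).
    rewrite Rintegral_cst//= lebesgue_measure_itv/= lte_fin.
    by rewrite ifT; [rewrite /=; congr (_ * _); ring|lra].
  apply: le_Rintegral => //.
    by apply: continuous_integrable_itv; exact: cst_continuous.
  move=> x; rewrite /= in_itv/= => /andP[? ?].
  have : ball c d x by rewrite /ball/= ltr_norml; lra.
  by move=> /hd; rewrite ltr_norml => /andP[_]; lra.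
have : 0 < f c / 2 * (r + r) by rewrite mulr_gt0 ?divr_gt0// addr_gt0.
move=> /lt_le_trans; apply; apply: (le_trans p2).
by rewrite addrCA lerDl addr_ge0.
Qed.

Lemma exists_bump_integral_neq0 (g : R -> R) : continuous g -> g (1 / 2) != 0 ->
  exists e : R -> R, [/\ smooth e, (forall x, 0 <= e x <= 1),
    (forall x, ~~ (0 < x < 1) -> e x = 0) &
    \int[mu]_(x in `[0, 1]) (e x * g x) != 0].
Proof.
wlog g0 : g / 0 < g (1 / 2).
  move=> wl cg gn0; have [|gneg] := ltP 0 (g (1 / 2)); first by move=> /wl; exact.
  have cgN : continuous (fun x => - g x) by move=> x; apply: cvgN; exact: cg.
  have gneg' : 0 < - g (1 / 2) by rewrite oppr_gt0 lt_neqAle gn0.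
  have [e [e1 e2 e3 e4]] := wl (fun x => - g x) gneg' cgN (lt0r_neq0 gneg').
  exists e; split => //; apply: contra e4 => /eqP e0; apply/eqP.
  rewrite (_ : \int[mu]_(x in `[0, 1]) (e x * - g x) =
     \int[mu]_(x in `[0, 1]) (-1 * (e x * g x))).
    rewrite RintegralZl// ?e0 ?mulr0//.
    apply: continuous_integrable_itv => x; apply: cvgM; last exact: cg.
    exact: (@smooth_continuous _ _ 0 e1).
  by apply: eq_Rintegral => x _; ring.
move=> cg _.
have /cvgrPdist_lt /(_ (g (1 / 2)) g0) /nbhs_ballP[d /= d0 hd] := cg (1 / 2).
pose r := Num.min d (1 / 2).
have r0 : 0 < r by rewrite lt_min d0 divr_gt0.
have rd : r <= d by rewrite /r ge_min lexx.
have r2 : r <= 1 / 2 by rewrite /r ge_min lexx orbT.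
exists (mollifier (1 / 2 - r) (1 / 2 + r)); split.
- exact: smooth_mollifier.
- by move=> x; rewrite mollifier_ge0 mollifier_le1.
- by move=> x h; apply: mollifier_out; apply: contra h => /andP[? ?]; apply/andP; lra.
apply: lt0r_neq0; apply: (@Rint_gt0 _ 0 1 (1 / 2)); try lra.
- move=> x; apply: cvgM; last exact: cg.
  exact: (@smooth_continuous _ _ 0 (@smooth_mollifier _ _ _)).
- move=> x _; have [xr|xr] := boolP (1 / 2 - r < x < 1 / 2 + r); last first.
    by rewrite mollifier_out// mul0r.
  rewrite mulr_ge0 ?mollifier_ge0//.
  have : ball (1 / 2 : R) d x by rewrite /ball/= ltr_norml; lra.
  by move=> /hd; rewrite ltr_norml => /andP[_]; lra.
- by rewrite mulr_gt0// mollifier_gt0//; apply/andP; lra.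
Qed.

(** [resX] and [resY] are the real and imaginary parts of the integral of e (a + ib)^2. *)
Definition resX (e a b : R -> R) := \int[mu]_(x in `[0, 1]) (e x * (a x ^+ 2 - b x ^+ 2)).
Definition resY (e a b : R -> R) := \int[mu]_(x in `[0, 1]) (e x * (2 * a x * b x)).

Section basis.
Variables (V0 : R -> R) (E kappa : R) (a b a' b' : R -> R) (W : R).
Hypothesis fb : floquet_basis V0 E kappa a b a' b' W.

Lemma continuous_squares :
  continuous (fun x => a x ^+ 2 - b x ^+ 2) /\ continuous (fun x => 2 * a x * b x).
Proof.
have [ca cb _ _] := floquet_continuous fb.
split => x.
  by apply: cvgB; apply: (@cvg_comp _ _ _ _ (fun x : R => x ^+ 2));
    try exact: exprn_continuous; [exact: ca|exact: cb].
by apply: cvgM; [apply: cvgM; [exact: cvg_cst|exact: ca]|exact: cb].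
Qed.

(** A Floquet solution has no zero, so the real or the imaginary part of its square is nonzero at
    1/2, and a narrow bump around 1/2 sees it with a constant sign. *)
Lemma exists_resonant_bump : exists e : R -> R,
  [/\ smooth e, (forall x, 0 <= e x <= 1),
    (forall x, ~~ (0 < x < 1) -> e x = 0) &
    0 < resX e a b ^+ 2 + resY e a b ^+ 2].
Proof.
have [c1 c2] := continuous_squares.
have := floquet_neq0 fb (1 / 2).
have [X0|X0 _] := eqVneq (a (1 / 2) ^+ 2 - b (1 / 2) ^+ 2) 0; last first.
  have [e [e1 e2 e3 e4]] := exists_bump_integral_neq0 c1 X0.
  by exists e; split => //; rewrite ltr_pwDl// ?sqr_ge0// exprn_even_gt0.
move=> r0; have Y0 : 2 * a (1 / 2) * b (1 / 2) != 0.
  apply: contraTneq r0 => Y0; rewrite -leNgt -[leLHS]ger0_norm ?addr_ge0 ?sqr_ge0//.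
  rewrite -sqr_le_norm// expr0n/= (_ : _ ^+ 2 = (a (1 / 2) ^+ 2 - b (1 / 2) ^+ 2) ^+ 2 +
    (2 * a (1 / 2) * b (1 / 2)) ^+ 2); last by ring.
  by rewrite X0 Y0 expr0n addr0.
have [e [e1 e2 e3 e4]] := exists_bump_integral_neq0 c2 Y0.
by exists e; split => //; rewrite ltr_wpDl// ?sqr_ge0// exprn_even_gt0.
Qed.

Lemma floquet_cell (e : R -> R) (T U : R) n : continuous e ->
  \int[mu]_(x in `[0, 1]) (e x *
    ((a (x + n%:R) ^+ 2 - b (x + n%:R) ^+ 2) * T -
     (2 * a (x + n%:R) * b (x + n%:R)) * U)) =
  wave kappa (resX e a b * T - resY e a b * U)
             (- (resY e a b * T + resX e a b * U)) n.
Proof.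
move=> ce; have [c1 c2] := continuous_squares.
have i1 : mu.-integrable `[0, 1] (EFin \o (fun x => e x * (a x ^+ 2 - b x ^+ 2))).
  by apply: continuous_integrable_itv => x; apply: cvgM; [exact: ce|exact: c1].
have i2 : mu.-integrable `[0, 1] (EFin \o (fun x => e x * (2 * a x * b x))).
  by apply: continuous_integrable_itv => x; apply: cvgM; [exact: ce|exact: c2].
rewrite /wave; set C := cos _; set S := sin _.
rewrite (_ : \int[mu]_(x in _) _ = \int[mu]_(x in `[0, 1])
  ((C * T - S * U) * (e x * (a x ^+ 2 - b x ^+ 2)) +
   (- (S * T + C * U)) * (e x * (2 * a x * b x)))).
  rewrite RintegralD//; last 2 first.
  - exact: integrableZl_EFin.
  - exact: integrableZl_EFin.
  by rewrite !RintegralZl// -/(resX e a b) -/(resY e a b); ring.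
apply: eq_Rintegral => x _; have [-> ->] := floquet_rotation fb n x.
have -> : C = cos (kappa * n%:R) ^+ 2 - sin (kappa * n%:R) ^+ 2.
  rewrite /C (_ : 2 * kappa * n%:R = kappa * n%:R + kappa * n%:R) ?cosD; ring.
have -> : S = 2 * cos (kappa * n%:R) * sin (kappa * n%:R).
  rewrite /S (_ : 2 * kappa * n%:R = kappa * n%:R + kappa * n%:R) ?sinD; ring.
ring.
Qed.

End basis.

(** The interval contains all sums and differences of two quasimomenta, and its only zeros of the
    sine are the two excluded points. *)
Lemma sin_neq0_interval (x : R) : - pi < x < 2 * pi -> x != 0 -> x != pi ->
  sin x != 0.
Proof.
move=> /andP[x1 x2] x0 xpi.
have [xn|xp|/eqP] := ltgtP x 0; last by rewrite (negbTE x0).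
  by rewrite -oppr_eq0 -sinN gt_eqF// sin_gt0_pi// oppr_gt0 xn ltrNl.
have [xlt|xgt|/eqP] := ltgtP x pi; last by rewrite (negbTE xpi).
  by rewrite gt_eqF// sin_gt0_pi// xp.
have -> : x = (x - pi) + pi by rewrite subrK.
by rewrite sinDpi oppr_eq0 gt_eqF// sin_gt0_pi// subr_gt0 xgt ltrBlDr; lra.
Qed.

End resonant_bump.

(** * The feedback potential *)

Section control.
Context {R : realType}.
Notation mu := (@lebesgue_measure R).
Variables (V0 : R -> R) (E kappa W C : nat -> R) (a b a' b' : nat -> R -> R).
Variable eta : nat -> R -> R.
Hypothesis fb : forall j,
  floquet_basis V0 (E j) (kappa j) (a j) (b j) (a' j) (b' j) (W j).
Hypothesis kappa_range : forall j, 0 < kappa j < pi.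
Hypothesis kappa_inj : forall i j, i <> j -> kappa i <> kappa j.
Hypothesis kappa_nonres : forall i j, kappa i + kappa j <> pi.
Hypothesis C_ge0 : forall j, 0 <= C j.
Hypothesis ab_le : forall j x, 0 <= x -> `|a j x| <= C j /\ `|b j x| <= C j.
Hypothesis eta_smooth : forall i, smooth (eta i).
Hypothesis eta01 : forall i x, 0 <= eta i x <= 1.
Hypothesis eta_out : forall i x, ~~ (0 < x < 1) -> eta i x = 0.
Hypothesis eta_res : forall i,
  0 < resX (eta i) (a i) (b i) ^+ 2 + resY (eta i) (a i) (b i) ^+ 2.
Implicit Types (m n i j : nat).

Let X i j := resX (eta i) (a j) (b j).
Let Y i j := resY (eta i) (a j) (b j).

Definition energy (z : R * R) := z.1 ^+ 2 + z.2 ^+ 2.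

(** Amplitudes of the wave through which bump i acts on the energy of state j: [floquet_cell] with T
    = 2 z1 z2 and U = z1^2 - z2^2. *)
Definition ampP i j (z : R * R) := X i j * (2 * z.1 * z.2) - Y i j * (z.1 ^+ 2 - z.2 ^+ 2).
Definition ampQ i j (z : R * R) := - (Y i j * (2 * z.1 * z.2) + X i j * (z.1 ^+ 2 - z.2 ^+ 2)).

Let D i j := 2 * (`|X i j| + `|Y i j|).
Let B j := X j j ^+ 2 + Y j j ^+ 2.

Lemma energy_ge0 z : 0 <= energy z.
Proof. by rewrite addr_ge0 ?sqr_ge0. Qed.

Lemma D_ge0 i j : 0 <= D i j. Proof. by rewrite mulr_ge0// addr_ge0. Qed.

Lemma amp_bound i j z : `|ampP i j z| + `|ampQ i j z| <= D i j * energy z.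
Proof.
have hT : `|2 * z.1 * z.2| <= energy z.
  rewrite ler_norml /energy; have := sqr_ge0 (z.1 + z.2); have := sqr_ge0 (z.1 - z.2); nra.
have hU : `|z.1 ^+ 2 - z.2 ^+ 2| <= energy z.
  by rewrite ler_norml /energy; have := sqr_ge0 z.1; have := sqr_ge0 z.2; lra.
rewrite /ampP /ampQ /D normrN; move: (2 * z.1 * z.2) (_ - _) (energy z) hT hU => T U e hT hU.
have bnd x y : `|x * T + y * U| <= (`|x| + `|y|) * e.
  by rewrite (le_trans (ler_normD _ _))// !normrM mulrDl lerD// ler_wpM2l.
have := bnd (X i j) (- Y i j); have := bnd (Y i j) (X i j).
rewrite mulNr normrN; lra.
Qed.

Lemma amp_sqr j z : ampP j j z ^+ 2 + ampQ j j z ^+ 2 = B j * energy z ^+ 2.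
Proof. by rewrite /ampP /ampQ /B /energy; ring. Qed.

(* The first-order change of the energy of state j is the correlation of the
   control with wave j, so minus wave i pushes the energy of state i down. *)
Definition control m (eps : R) (z : nat -> R * R) n i :=
  if (i < m)%N then
    - eps / (W i * energy (z i)) * wave (kappa i) (ampP i i (z i)) (ampQ i i (z i)) n
  else 0.

Lemma wave_bound k P Q n : `|wave k P Q n| <= `|P| + `|Q| :> R.
Proof.
rewrite (le_trans (ler_normD _ _))// !normrM lerD// ler_piMr//.
  by rewrite ler_norml cos_geN1 cos_le1.
by rewrite ler_norml sin_geN1 sin_le1.
Qed.

(** An inequality because the energy of an arbitrary state may be 0, whose inverse is 0 by
    convention. *)
Lemma mulVr_le1 (x : R) : 0 <= x -> x^-1 * x <= 1.
Proof. by case: ltgtP => // [x0 _|<- _]; [rewrite mulVf ?gt_eqF|rewrite mulr0]. Qed.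

(** Amplitudes are quadratic in the state, so dividing by the energy makes the size of the potential
    independent of how small the states have become. *)
Lemma control_bound m eps (z : nat -> R * R) n i : 0 <= eps ->
  `|control m eps z n i| <= eps * (D i i / `|W i|).
Proof.
move=> eps0; rewrite /control; case: ifP => _; last first.
  by rewrite normr0 mulr_ge0// divr_ge0// D_ge0.
rewrite invfM !normrM normrN !normfV (ger0_norm eps0) (ger0_norm (energy_ge0 _)).
have := wave_bound (kappa i) (ampP i i (z i)) (ampQ i i (z i)) n.
move=> /le_trans/(_ (amp_bound _ _ _)) h.
have e0 := energy_ge0 (z i).
have h1 : (energy (z i))^-1 * `|wave (kappa i) (ampP i i (z i)) (ampQ i i (z i)) n| <= D i i.
  apply: le_trans (ler_wpM2l _ h) _; first by rewrite invr_ge0.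
  by rewrite mulrCA ler_piMr ?D_ge0 ?mulVr_le1.
rewrite (_ : _ * `|wave _ _ _ _| = eps * ((energy (z i))^-1 *
  `|wave (kappa i) (ampP i i (z i)) (ampQ i i (z i)) n| / `|W i|)); last by ring.
by rewrite ler_wpM2l// ler_wpM2r// invr_ge0.
Qed.

Let G j := `|sin (2 * kappa j)|^-1.
Let K i j := (`|sin (kappa i - kappa j)|^-1 + `|sin (kappa i + kappa j)|^-1) *
  (D i i * D i j) / (`|W i| * `|W j|).

Lemma K_ge0 i j : 0 <= K i j.
Proof. by rewrite /K divr_ge0 ?mulr_ge0 ?D_ge0. Qed.

Lemma sin_kappaD i j : sin (kappa i + kappa j) != 0.
Proof.
have /andP[i0 ipi] := kappa_range i; have /andP[j0 jpi] := kappa_range j.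
apply: sin_neq0_interval; last exact/eqP/kappa_nonres.
  by apply/andP; lra.
by rewrite gt_eqF// addr_gt0.
Qed.

Lemma sin_kappaB i j : i <> j -> sin (kappa i - kappa j) != 0.
Proof.
move=> ij; have /andP[i0 ipi] := kappa_range i; have /andP[j0 jpi] := kappa_range j.
apply: sin_neq0_interval; first by apply/andP; lra.
  by rewrite subr_eq0; exact/eqP/kappa_inj.
by rewrite lt_eqF//; lra.
Qed.

Let Wn0 j : W j != 0. Proof. by case: (fb j) => _ _ _ _ []. Qed.

(** The diagonal part is minus a sum of squares and grows linearly in N; the cross terms are bounded
    uniformly in N by the constants [K]. A long block therefore lowers all m energies
    simultaneously. *)
Lemma control_gain m eps (z : nat -> R * R) n N j : 0 <= eps -> (j < m)%N ->
  (W j)^-1 * \sum_(k < N) \sum_(i < m) control m eps z (n + k) i *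
     wave (kappa j) (ampP i j (z j)) (ampQ i j (z j)) (n + k) <=
  - eps * energy (z j) *
    (B j / W j ^+ 2 * (N%:R / 2 - G j) - \sum_(i < m) K i j).
Proof.
move=> eps0 jm.
rewrite exchange_big/= mulr_sumr (bigD1 (Ordinal jm))//=.
have e0 i := energy_ge0 (z i).
rewrite mulrBr; apply: lerD.
  rewrite (_ : _^-1 * _ = - eps * ((W j ^+ 2)^-1 * (energy (z j))^-1 *
    \sum_(k < N) wave (kappa j) (ampP j j (z j)) (ampQ j j (z j)) (n + k) ^+ 2)).
    rewrite !mulNr lerN2 -mulrA ler_wpM2l//.
    (* At zero energy the control is 0 by the convention on inverses, and both sides vanish. *)
    have [ej|ej] := eqVneq (energy (z j)) 0; first by rewrite ej invr0 mulr0 !mul0r.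
    have s2 : sin (2 * kappa j) != 0.
      by rewrite (_ : 2 * kappa j = kappa j + kappa j) ?sin_kappaD//; ring.
    have := wave_sqr_sum n N (ampP j j (z j)) (ampQ j j (z j)) s2.
    rewrite amp_sqr -/(G j) => h.
    have We : 0 <= (W j ^+ 2)^-1 * (energy (z j))^-1.
      by rewrite mulr_ge0 ?invr_ge0 ?sqr_ge0.
    apply: le_trans (ler_wpM2l We h); rewrite le_eqVlt; apply/orP; left; apply/eqP.
    by field; rewrite ej Wn0.
  rewrite !mulr_sumr; apply: eq_bigr => k _; rewrite /control jm invfM expr2 invfM; ring.
rewrite [leRHS](_ : _ = eps * energy (z j) * \sum_(i < m) K i j); last by ring.
apply: le_trans (_ : \sum_(i < m | i != Ordinal jm) eps * energy (z j) * K i j <= _).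
  apply: ler_sum => i ij.
  have ij' : (i : nat) <> j by move/eqP: ij => ij ?; apply: ij; exact: val_inj.
  apply: le_trans (ler_norm _) _.
  rewrite (_ : _^-1 * _ = - eps / (W i * W j) * (energy (z i))^-1 *
    \sum_(k < N) wave (kappa i) (ampP i i (z i)) (ampQ i i (z i)) (n + k) *
                 wave (kappa j) (ampP i j (z j)) (ampQ i j (z j)) (n + k)); last first.
    rewrite !mulr_sumr; apply: eq_bigr => k _.
    by rewrite /control ltn_ord !invfM; ring.
  have := wave_mul_sum n N (ampP i i (z i)) (ampQ i i (z i)) (ampP i j (z j))
    (ampQ i j (z j)) (sin_kappaB ij') (sin_kappaD i j).
  set S := \sum_(_ < _) _; set g := (_ + _) => hS.
  have g0 : 0 <= g by rewrite addr_ge0// invr_ge0.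
  have {}hS : `|S| <= g * ((D i i * energy (z i)) * (D i j * energy (z j))).
    apply: le_trans hS _; rewrite ler_wpM2l//.
    by apply: ler_pM; rewrite ?addr_ge0//; exact: amp_bound.
  rewrite !normrM normrN !normfV normrM (ger0_norm eps0) (ger0_norm (e0 i)).
  have i0 : 0 <= eps / (`|W i| * `|W j|) by rewrite divr_ge0// mulr_ge0.
  have := ler_wpM2l (_ : 0 <= (energy (z i))^-1) hS.
  rewrite invr_ge0 e0 => /(_ isT) h1.
  have h2 : (energy (z i))^-1 * `|S| <= g * (D i i * D i j) * energy (z j).
    apply: le_trans h1 _.
    rewrite (_ : _^-1 * _ = ((energy (z i))^-1 * energy (z i)) *
      (g * (D i i * D i j) * energy (z j))); last by ring.
    by rewrite ler_piMl ?mulVr_le1// !mulr_ge0 ?D_ge0.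
  rewrite -mulrA; apply: le_trans (ler_wpM2l i0 h2) _.
  by rewrite /K -/g le_eqVlt; apply/orP; left; apply/eqP; ring.
(* The nonnegative term i = j is added so that the bound is a sum over all i < m. *)
rewrite mulr_sumr [leRHS](bigD1 (Ordinal jm))//= lerDr.
by rewrite mulr_ge0 ?K_ge0// mulr_ge0.
Qed.

(** Obtained by solving B / W^2 (N/2 - G) - sum K >= 1 for N. *)
Definition block_length_for m j :=
  (Num.truncn (2 * (G j + (1 + \sum_(i < m) K i j) * (W j ^+ 2 / B j)))).+1.

(** The sum serves as a common upper bound over j < m; the successor makes blocks nonempty even for
    m = 0, so that positions always advance. *)
Definition block_length m := (\sum_(j < m) block_length_for m j).+1.

Lemma block_length_gain m j : (j < m)%N ->
  1 <= B j / W j ^+ 2 * ((block_length m)%:R / 2 - G j) - \sum_(i < m) K i j.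
Proof.
move=> jm; have B0 : 0 < B j by exact: eta_res.
have W2 : 0 < W j ^+ 2 by rewrite exprn_even_gt0//= Wn0.
have : (block_length_for m j)%:R <= (block_length m)%:R :> R.
  rewrite ler_nat /block_length (bigD1 (Ordinal jm))//=.
  by apply: leqW; exact: leq_addr.
have := truncnS_gt (2 * (G j + (1 + \sum_(i < m) K i j) * (W j ^+ 2 / B j))).
rewrite -/(block_length_for m j).
set S := \sum_(_ < _) _; set L := (block_length m)%:R => h1 h2.
have h : (1 + S) * (W j ^+ 2 / B j) <= L / 2 - G j by lra.
have := ler_wpM2l (_ : 0 <= B j / W j ^+ 2) h.
rewrite divr_ge0 ?(ltW B0) ?(ltW W2)// => /(_ isT).
rewrite (_ : B j / W j ^+ 2 * _ = 1 + S); first by lra.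
by field; rewrite Wn0 gt_eqF.
Qed.

Definition amplitude m := \sum_(i < m) D i i / `|W i|.

Lemma amplitude_ge0 m : 0 <= amplitude m.
Proof. by apply: sumr_ge0 => i _; rewrite divr_ge0 ?D_ge0. Qed.

(** This is [rho] / eps for state j over one block: the second-order error is 32 (eps *
    [second_order m j])^2 times the energy. *)
Definition second_order m j :=
  amplitude m * C j ^+ 2 / `|W j| * (block_length m)%:R.

Lemma second_order_ge0 m j : 0 <= second_order m j.
Proof.
by rewrite mulr_ge0// divr_ge0// mulr_ge0 ?amplitude_ge0// exprn_ge0.
Qed.

(** Under eps * [threshold m] <= 1 the two summands give, for every j < m, 2 rho <= 1/2 (needed for
    [state_growth]) and 32 rho^2 <= eps/2 (half of the gain survives). *)
Definition threshold m :=
  \sum_(j < m) (4 * second_order m j + 64 * second_order m j ^+ 2).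

Lemma sum_ord_trunc (F : nat -> R) m n : (m <= n)%N ->
  (forall i, (m <= i)%N -> F i = 0) -> \sum_(i < n) F i = \sum_(i < m) F i.
Proof.
move=> mn F0; rewrite (big_ord_widen n F mn) [RHS]big_mkcond/=.
by apply: eq_bigr => i _; case: ltnP => // /F0.
Qed.

(** * The effect of one block *)

Section block.
Variables (m n : nat) (eps : R) (c : nat -> nat -> R) (z : nat -> R * R).
Hypotheses (mn : (m <= n)%N) (eps0 : 0 <= eps).
Hypothesis cE : forall k i, (n <= k < n + block_length m)%N ->
  c k i = control m eps z k i.
Let N := block_length m.

Lemma potential_block_bound x : n%:R <= x <= (n + N)%:R ->
  `|potential eta c x| <= eps * amplitude m.
Proof.
move=> /andP[nx xn].
(* The right end of the block is assigned to its last cell, since the next cell belongs to another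
   block. *)
have [k kN xk] : exists2 k, (k < N)%N & (n + k)%:R <= x <= (n + k).+1%:R.
  move: xn; rewrite le_eqVlt => /predU1P[->|xn].
    by exists N.-1 => //; rewrite -addnS /= lexx ler_nat leq_add2l leqnSn.
  have x0 : 0 <= x by exact: le_trans nx.
  have /andP[t1 t2] := truncn_itv x0.
  have nt : (n <= Num.truncn x)%N by rewrite truncn_ge_nat.
  exists (Num.truncn x - n)%N; last by rewrite subnKC// t1 ltW.
  by rewrite ltn_subLR// truncn_lt_nat.
apply: le_trans (potential_bound eta01 eta_out _ xk) _.
rewrite (@sum_ord_trunc (fun i => `|c (n + k)%N i|) m).
- rewrite mulr_sumr; apply: ler_sum => i _.
  by rewrite cE ?leq_addr ?ltn_add2l//; exact: control_bound.
- exact: leq_trans mn (leq_addr _ _).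
- by move=> i mi; rewrite cE ?leq_addr ?ltn_add2l// /control ltnNge mi normr0.
Qed.

Lemma Rint_block j :
  \int[mu]_(x in `[n%:R, (n + N)%:R]) (potential eta c x *
      ((a j x ^+ 2 - b j x ^+ 2) * (2 * (z j).1 * (z j).2) -
       (2 * a j x * b j x) * ((z j).1 ^+ 2 - (z j).2 ^+ 2))) =
  \sum_(k < N) \sum_(i < m) control m eps z (n + k) i *
     wave (kappa j) (ampP i j (z j)) (ampQ i j (z j)) (n + k).
Proof.
have [c1 c2] := continuous_squares (fb j).
set T := 2 * (z j).1 * (z j).2; set U := (z j).1 ^+ 2 - (z j).2 ^+ 2.
pose f x := (a j x ^+ 2 - b j x ^+ 2) * T - 2 * a j x * b j x * U.
have cf : continuous f.
  by move=> x; apply: cvgB; apply: cvgM; try exact: cvg_cst; [exact: c1|exact: c2].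
rewrite Rint_cells; last first.
  by move=> x; apply: cvgM; [exact: continuous_potential|exact: cf].
apply: eq_bigr => k _; rewrite (Rint_potential eta_smooth eta_out c _ cf).
rewrite (@sum_ord_trunc (fun i => c (n + k)%N i *
   \int[mu]_(x in `[0, 1]) (eta i x * f (x + (n + k)%:R))) m).
- apply: eq_bigr => i _; rewrite cE ?leq_addr ?ltn_add2l ?ltn_ord//; congr (_ * _).
  rewrite (floquet_cell (fb j))//.
  exact: (@smooth_continuous _ _ 0 (@eta_smooth i)).
- exact: leq_trans mn (leq_addr _ _).
- by move=> i mi; rewrite cE ?leq_addr ?ltn_add2l ?ltn_ord// /control ltnNge mi mul0r.
Qed.

Lemma block_decay j (z1 z2 : R -> R) : (j < m)%N -> eps * threshold m <= 1 ->
  state_equation (a j) (b j) (potential eta c) (W j) z1 z2 ->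
  z j = (z1 n%:R, z2 n%:R) ->
  energy (z1 (n + N)%:R, z2 (n + N)%:R) <= (1 - eps / 2) * energy (z j) /\
  forall x, n%:R <= x <= (n + N)%:R ->
    `|z1 x| + `|z2 x| <= 2 * (`|z1 n%:R| + `|z2 n%:R|).
Proof.
move=> jm epsL zE zj.
have [ca cb _ _] := floquet_continuous (fb j).
have cV := @continuous_potential _ _ eta_smooth eta_out c.
have H0 := second_order_ge0 m j.
have epsH : eps * (4 * second_order m j + 64 * second_order m j ^+ 2) <= 1.
  apply: le_trans epsL; rewrite ler_wpM2l// /threshold (bigD1 (Ordinal jm))//= lerDl.
  apply: sumr_ge0 => i _; have := second_order_ge0 m i => Hi.
  by apply: addr_ge0; apply: mulr_ge0 => //; exact: sqr_ge0.
have rhoE : eps * amplitude m * C j ^+ 2 / `|W j| * ((n + N)%:R - n%:R) =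
    eps * second_order m j.
  by rewrite /second_order natrD -/N; ring.
have nN : n%:R <= (n + N)%:R :> R by rewrite ler_nat leq_addr.
have eA : 0 <= eps * amplitude m by rewrite mulr_ge0 ?amplitude_ge0.
have abC x : n%:R <= x <= (n + N)%:R -> `|a j x| <= C j /\ `|b j x| <= C j.
  by move=> /andP[nx _]; apply: ab_le; exact: le_trans nx.
have eH : 0 <= eps * second_order m j by rewrite mulr_ge0.
have eH2 : 0 <= eps * second_order m j ^+ 2 by rewrite mulr_ge0 ?exprn_ge0.
have small : 2 * (eps * amplitude m * C j ^+ 2 / `|W j| * ((n + N)%:R - n%:R)) <= 1 / 2.
  by rewrite rhoE; lra.
split; last first.
  exact: (state_growth ca cb cV zE (ler0n R n) nN (C_ge0 j) eA abC potential_block_bound small).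
have := state_block_estimate ca cb cV zE (ler0n R n) nN (C_ge0 j) eA abC
  potential_block_bound small.
rewrite rhoE.
have -> : z1 n%:R = (z j).1 by rewrite zj.
have -> : z2 n%:R = (z j).2 by rewrite zj.
rewrite Rint_block => /le_trans; apply.
have := control_gain z n N eps0 jm.
have := ler_wpM2l (mulr_ge0 eps0 (energy_ge0 (z j))) (block_length_gain jm).
rewrite mulr1 -/N -/(energy (z j)).
have : 32 * (eps * second_order m j) ^+ 2 * energy (z j) <= eps / 2 * energy (z j).
  rewrite ler_wpM2r ?energy_ge0//.
  have -> : 32 * (eps * second_order m j) ^+ 2 =
    eps / 2 * (eps * (64 * second_order m j ^+ 2)) by field.
  by rewrite ler_piMr ?divr_ge0//; lra.
rewrite !mulNr; set S := \sum_(_ < _) _; set Z := eps * _ * (_ - _) => h1 h2 h3.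
lra.
Qed.

End block.

(** * Recursive choice of the coefficients *)

Section recursion.
Variables (h : R -> R) (z0 : nat -> R * R).
Hypothesis h_gt0 : forall x, 0 < x -> 0 < h x.
Hypothesis h_infty : h x @[x --> +oo] --> +oo.
Implicit Types c : nat -> nat -> R.

Let V c := potential eta c.

(** Defined for an arbitrary table [c], before any feedback, so that the recursion can consult
    it. *)
Definition usol c j := volterra_sol
  (fun x => (z0 j).1 * a j x + (z0 j).2 * b j x) (a j) (b j)
  (fun t => - (V c t * b j t / W j)) (fun t => V c t * a j t / W j).

Definition zsol1 c j x :=
  (z0 j).1 + int0 (fun t => - (V c t * b j t / W j) * usol c j t) x.

Definition zsol2 c j x :=
  (z0 j).2 + int0 (fun t => V c t * a j t / W j * usol c j t) x.

Lemma usol_continuity c j : [/\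
  continuous (fun x => (z0 j).1 * a j x + (z0 j).2 * b j x),
  continuous (fun t => - (V c t * b j t / W j)) &
  continuous (fun t => V c t * a j t / W j)].
Proof.
have [ca cb _ _] := floquet_continuous (fb j).
have cV := @continuous_potential _ _ eta_smooth eta_out c.
split=> t.
- by apply: cvgD; (apply: cvgM; first exact: cvg_cst); [exact: ca|exact: cb].
- apply: cvgN; apply: cvgM; last exact: cvg_cst.
  by apply: cvgM; [exact: cV|exact: cb].
- apply: cvgM; last exact: cvg_cst.
  by apply: cvgM; [exact: cV|exact: ca].
Qed.

Lemma continuous_usol c j : continuous (usol c j).
Proof.
have [ca cb _ _] := floquet_continuous (fb j).
have [c1 c2 c3] := usol_continuity c j.
exact: continuous_volterra_sol.
Qed.

Lemma usolE c j x : usol c j x = zsol1 c j x * a j x + zsol2 c j x * b j x.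
Proof.
have [ca cb _ _] := floquet_continuous (fb j).
have [c1 c2 c3] := usol_continuity c j.
rewrite /usol volterra_solE// /volterra /zsol1 /zsol2 -/(usol c j); ring.
Qed.

Lemma int00 (f : R -> R) : int0 f 0 = 0.
Proof. by rewrite /int0 set_itv1 Rintegral_set1. Qed.

Lemma zsol_state_equation c j :
  state_equation (a j) (b j) (V c) (W j) (zsol1 c j) (zsol2 c j).
Proof.
have [c1 c2 c3] := usol_continuity c j.
have cu := @continuous_usol c j.
have usolF : usol c j = fun t => zsol1 c j t * a j t + zsol2 c j t * b j t.
  by apply/funext => t; exact: usolE.
split.
- move=> x; apply: cvgD; first exact: cvg_cst.
  by apply: continuous_int0 => t; apply: cvgM; [exact: c2|exact: cu].
- move=> x; apply: cvgD; first exact: cvg_cst.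
  by apply: continuous_int0 => t; apply: cvgM; [exact: c3|exact: cu].
- by move=> x _; rewrite {1 2}/zsol1 int00 addr0 usolF.
- by move=> x _; rewrite {1 2}/zsol2 int00 addr0 usolF.
Qed.

(** This removes the circularity: rows from M on may be prescribed by the states at M without
    altering those states. *)
Lemma zsol_local c c' M j : (forall n i, (n < M)%N -> c n i = c' n i) ->
  zsol1 c j M%:R = zsol1 c' j M%:R /\ zsol2 c j M%:R = zsol2 c' j M%:R.
Proof.
move=> cc.
have VV x : x <= M%:R -> V c x = V c' x by exact: potential_local.
have uu x : x <= M%:R -> usol c j x = usol c' j x.
  by apply: volterra_sol_local => t /andP[_ tM]; rewrite (VV t tM).
have eq_int0 (f g : R -> R) : (forall t, t <= M%:R -> f t = g t) ->
    int0 f M%:R = int0 g M%:R.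
  move=> fg; apply: eq_Rintegral => t; rewrite inE/= in_itv/= => /andP[_].
  exact: fg.
rewrite /zsol1 /zsol2; split.
  apply: (f_equal (fun r => (z0 j).1 + r)); apply: eq_int0 => t tM.
  by rewrite (VV t tM) (uu t tM).
apply: (f_equal (fun r => (z0 j).2 + r)); apply: eq_int0 => t tM.
by rewrite (VV t tM) (uu t tM).
Qed.

(** All that a block starting at n needs in order to treat m energies: its length at most doubles
    the position, eps = 8N/n is below the threshold, and h exceeds 24 N times the amplitude, where
    24 = 3 * 8 since 1 + x <= 3n on the block. *)
Lemma exists_stage_threshold m : exists T : nat, forall n, (T <= n)%N ->
  [/\ (0 < n)%N, (block_length m <= n)%N,
      8 * (block_length m)%:R / n%:R * threshold m <= 1 &
      forall x, n%:R <= x -> 24 * (block_length m)%:R * amplitude m <= h x].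
Proof.
have [x0 [x0r hx0]] : exists x0 : R, x0 \is Num.real /\ forall x, x0 < x ->
    24 * (block_length m)%:R * amplitude m <= h x.
  have /cvgryPge /(_ (24 * (block_length m)%:R * amplitude m)) := h_infty.
  by move=> [x0 [x0r H]]; exists x0.
pose T := ((Num.truncn `|x0|).+1 + block_length m +
  (Num.truncn (8 * (block_length m)%:R * threshold m)).+1)%N.
exists T => n Tn; have n0 : (0 < n)%N.
  by apply: leq_trans Tn; rewrite /T addnS.
split => //.
- by apply: leq_trans Tn; rewrite /T addnAC leq_addl.
- rewrite mulrAC ler_pdivrMr ?ltr0n// mul1r.
  apply: le_trans (ltW (truncnS_gt _)) _; rewrite ler_nat.
  by apply: leq_trans Tn; rewrite /T leq_addl.
- move=> x nx; apply: hx0; apply: le_lt_trans (ler_norm x0) _.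
  apply: lt_le_trans (truncnS_gt _) _; apply: le_trans nx; rewrite ler_nat.
  by apply: leq_trans Tn; rewrite /T -addnA leq_addr.
Qed.

Definition stage_start := projT1 (choice exists_stage_threshold).

Lemma stage_startP m n : (stage_start m <= n)%N ->
  [/\ (0 < n)%N, (block_length m <= n)%N,
      8 * (block_length m)%:R / n%:R * threshold m <= 1 &
      forall x, n%:R <= x -> 24 * (block_length m)%:R * amplitude m <= h x].
Proof. exact: (projT2 (choice exists_stage_threshold)). Qed.

(** A counter that advances by at most one at a time, and to m only after [stage_start m]. Hence it
    stays below n, as the truncation in [cell] demands, and still tends to infinity. *)
Fixpoint stage n : nat :=
  if n is n'.+1 then
    if (stage_start (stage n').+1 <= n)%N then (stage n').+1 else stage n'
  else 0.

Lemma stage_le n : (stage n <= n)%N.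
Proof. by elim: n => //= n IH; case: ifP => _ //; exact: leqW. Qed.

Lemma stage_started n : stage n = 0%N \/ (stage_start (stage n) <= n)%N.
Proof.
elim: n => [|n IH]; first by left.
move=> /=; case: ifP => [|_]; first by right.
by case: IH => [|/leqW]; [left|right].
Qed.

Lemma stage_homo : {homo stage : m n / (m <= n)%N}.
Proof.
apply: homo_leq => [//|m n p|n]; first exact: leq_trans.
by rewrite /=; case: ifP => _; rewrite ?leqnSn ?leqnn.
Qed.

Lemma stage_unbounded m : exists n, (m <= stage n)%N.
Proof.
elim: m => [|m [n mn]]; first by exists 0%N.
pose n' := maxn n (stage_start m.+1).
have [mn'|mn'] := ltnP m (stage n'); first by exists n'.
exists n'.+1 => /=.
have -> : stage n' = m.
  apply/eqP; rewrite eqn_leq mn'/= (leq_trans mn)//.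
  by apply: stage_homo; exact: leq_maxl.
by rewrite ifT// (leq_trans (leq_maxr n _))// leqnSn.
Qed.

Definition block_eps n : R := 8 * (block_length (stage n))%:R / n%:R.

Definition block_step (s : nat * (nat -> nat -> R)) : nat * (nat -> nat -> R) :=
  let: (n, c) := s in
  let N := block_length (stage n) in
  ((n + N)%N, fun k i => if (n <= k < n + N)%N then
     control (stage n) (block_eps n) (fun j => (zsol1 c j n%:R, zsol2 c j n%:R)) k i
   else c k i).

Definition block_iter k := iter k block_step (0%N, fun _ _ => 0).

Definition pos k := (block_iter k).1.
Definition coef k := (block_iter k).2.

Lemma posS k : pos k.+1 = (pos k + block_length (stage (pos k)))%N.
Proof. by rewrite /pos /block_iter iterS -/(block_iter k); case: (block_iter k). Qed.

Lemma coefS k l i : coef k.+1 l i =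
  if (pos k <= l < pos k.+1)%N then
    control (stage (pos k)) (block_eps (pos k))
      (fun j => (zsol1 (coef k) j (pos k)%:R, zsol2 (coef k) j (pos k)%:R)) l i
  else coef k l i.
Proof.
rewrite posS /coef /pos /block_iter iterS -/(block_iter k).
by case: (block_iter k).
Qed.

Lemma pos_homo : {homo pos : k l / (k <= l)%N}.
Proof.
apply: homo_leq => [//|m n p|k]; first exact: leq_trans.
by rewrite posS leq_addr.
Qed.

Lemma pos_ge k : (k <= pos k)%N.
Proof.
elim: k => // k IH; rewrite posS -addn1; apply: leq_add => //.
Qed.

Lemma coef_stable k d l i : (l < pos k)%N -> coef (k + d) l i = coef k l i.
Proof.
move=> lk; elim: d => [|d IH]; first by rewrite addn0.
rewrite addnS coefS ifF//; apply/negbTE; rewrite negb_and -ltnNge.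
by rewrite (leq_trans lk)//; apply: pos_homo; exact: leq_addr.
Qed.

(** Blocks are nonempty, so l + 1 steps reach beyond position l, and row l is never rewritten
    afterwards. *)
Definition coefs l i := coef l.+1 l i.

Lemma coefsE k l i : (l < pos k)%N -> coefs l i = coef k l i.
Proof.
move=> lk; rewrite /coefs; have [kl|kl] := leqP k l.+1.
  by rewrite -(subnKC kl) coef_stable.
by rewrite -(subnKC (ltnW kl)) coef_stable// pos_ge.
Qed.

(** The limit table obeys the feedback law for its own solutions: by causality these agree at the
    start of block k with the solutions for the table known at that time. *)
Lemma coefs_block k l i : (pos k <= l < pos k.+1)%N ->
  coefs l i = control (stage (pos k)) (block_eps (pos k))
    (fun j => (zsol1 coefs j (pos k)%:R, zsol2 coefs j (pos k)%:R)) l i.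
Proof.
move=> /andP[kl lk].
have -> : (fun j => (zsol1 coefs j (pos k)%:R, zsol2 coefs j (pos k)%:R)) =
    (fun j => (zsol1 (coef k) j (pos k)%:R, zsol2 (coef k) j (pos k)%:R)).
  apply/funext => j.
  have [e1 e2] := @zsol_local coefs (coef k) (pos k) j (fun n i => @coefsE k n i).
  by rewrite e1 e2.
by rewrite (coefsE i lk) coefS kl lk.
Qed.

Lemma block_eps_ge0 n : 0 <= block_eps n.
Proof. by rewrite divr_ge0// mulr_ge0. Qed.

Lemma pos_cover (x : R) : 0 <= x -> exists k, (pos k)%:R <= x <= (pos k.+1)%:R.
Proof.
move=> x0; have ex : exists k, x < (pos k)%:R.
  exists (Num.truncn x).+1; apply: lt_le_trans (truncnS_gt x) _.
  by rewrite ler_nat pos_ge.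
case: (ex_minnP ex) => -[|k] xk kmin; first by rewrite ltNge x0 in xk.
exists k; rewrite (ltW xk) andbT leNgt; apply/negP => /kmin.
by rewrite ltnn.
Qed.

Lemma potential_le (x : R) : 0 < x -> `|V coefs x| <= h x / (1 + x).
Proof.
move=> x0; have [k xk] := pos_cover (ltW x0).
have hx := h_gt0 x0; have x1 : 0 < 1 + x by lra.
set n := pos k; set m := stage n.
have := @potential_block_bound m n (block_eps n) coefs
  (fun j => (zsol1 coefs j n%:R, zsol2 coefs j n%:R)) (stage_le n) (block_eps_ge0 n).
rewrite -posS => /(_ (fun l i => @coefs_block k l i) x xk) /le_trans; apply.
(* In stage 0 no bump is present, and the positivity of h suffices. *)
have [m0|] := stage_started n.
  by rewrite /m m0 /amplitude big_ord0 mulr0 divr_ge0// ltW.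
move=> /stage_startP[n0 Nn _ hN].
case/andP: xk => nx xn.
have := hN x nx; rewrite -/m => hx'.
have n0' : 0 < n%:R :> R by rewrite ltr0n.
have xn2 : x <= 2 * n%:R.
  apply: le_trans xn _; rewrite posS natrD -/n.
  have : (block_length m)%:R <= n%:R :> R by rewrite ler_nat.
  by rewrite -/m; lra.
have n1 : 1 <= n%:R :> R by rewrite ler1n.
rewrite ler_pdivlMr//; apply: le_trans hx'.
rewrite /block_eps -/m.
have A0 := amplitude_ge0 m.
rewrite (_ : 8 * _ / _ * _ * _ = (8 * (block_length m)%:R * amplitude m) * ((1 + x) / n%:R));
  last by ring.
rewrite (_ : 24 * _ * _ = 8 * (block_length m)%:R * amplitude m * 3); last by ring.
rewrite ler_wpM2l ?mulr_ge0// ler_pdivrMr//; lra.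
Qed.

Lemma block_energy_decay j k : (j < stage (pos k))%N ->
  (pos k.+1)%:R ^+ 2 * energy (zsol1 coefs j (pos k.+1)%:R, zsol2 coefs j (pos k.+1)%:R) <=
  (pos k)%:R ^+ 2 * energy (zsol1 coefs j (pos k)%:R, zsol2 coefs j (pos k)%:R) /\
  forall x, (pos k)%:R <= x <= (pos k.+1)%:R ->
    `|zsol1 coefs j x| + `|zsol2 coefs j x| <=
    2 * (`|zsol1 coefs j (pos k)%:R| + `|zsol2 coefs j (pos k)%:R|).
Proof.
set n := pos k; set m := stage n => jm.
have [|] := stage_started n; first by rewrite -/m => m0; rewrite m0 in jm.
move=> /stage_startP[n0 Nn eT _].
have := @block_decay m n (block_eps n) coefs
  (fun j => (zsol1 coefs j n%:R, zsol2 coefs j n%:R)) (stage_le n) (block_eps_ge0 n).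
rewrite -posS => /(_ (fun l i => @coefs_block k l i) j _ _ jm eT (zsol_state_equation coefs j) erefl).
move=> [dec grow]; split; last exact: grow.
have n0' : 0 < n%:R :> R by rewrite ltr0n.
have e0 := energy_ge0 (zsol1 coefs j n%:R, zsol2 coefs j n%:R).
apply: le_trans (ler_wpM2l (sqr_ge0 _) dec) _.
rewrite mulrA ler_wpM2r// posS natrD -/n -/m /block_eps -/m.
have : (block_length m)%:R <= n%:R :> R by rewrite ler_nat.
have : 0 <= (block_length m)%:R :> R by [].
move: (n%:R) (block_length m)%:R n0' => x y x0 y0 yx.
(* With x the position and y the block length, eps = 8y/x and the decay factor is (x - 4y)/x. It
   remains to see (x + y)^2 (x - 4y) <= x^3. *)
rewrite (_ : (x + y) ^+ 2 * _ = (x + y) ^+ 2 * (x - 4 * y) / x); last first.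
  by field; rewrite gt_eqF.
rewrite ler_pdivrMr// -subr_ge0.
rewrite (_ : _ - _ = x * (2 * x * y + 7 * y ^+ 2) + 4 * y ^+ 3); last by ring.
by rewrite addr_ge0 ?mulr_ge0 ?addr_ge0 ?exprn_ge0 ?mulr_ge0 ?exprn_ge0 ?(ltW x0).
Qed.

Lemma usol_decay j : exists2 L, 0 <= L &
  forall x, 0 <= x -> usol coefs j x ^+ 2 <= L * (oneDsqr x)^-1.
Proof.
have [n jn] := stage_unbounded j.+1.
have stk k : (n <= k)%N -> (j < stage (pos k))%N.
  by move=> nk; apply: leq_trans jn _; apply: stage_homo; exact: leq_trans (pos_ge k).
pose e k := energy (zsol1 coefs j (pos k)%:R, zsol2 coefs j (pos k)%:R).
pose M := (pos n)%:R ^+ 2 * e n.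
have decay k : (n <= k)%N -> (pos k)%:R ^+ 2 * e k <= M.
  move=> nk; rewrite -(subnKC nk); elim: (k - n)%N => [|d IH]; first by rewrite addn0.
  rewrite addnS; apply: le_trans IH; apply: (block_energy_decay _).1.
  by apply: stk; exact: leq_addr.
have cu := @continuous_usol coefs j.
have [L1 L10 hL1] := continuous_bounded_itv 0 (pos n)%:R cu.
have M0 : 0 <= M by rewrite mulr_ge0 ?energy_ge0 ?sqr_ge0.
have C2 : 0 <= C j ^+ 2 by rewrite exprn_ge0.
have one (x : R) : 0 < oneDsqr x by apply: lt_le_trans (oneDsqr_ge1 x).
(* The first term covers the compact part before energy j is treated. In the second, 64 = 4 * 2 * 8:
   growth by 2 inside a block, squared; the squared sum against the energy; and 1 + x^2 <= 8 n^2 for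
   a block starting at n. *)
exists (L1 ^+ 2 * (1 + (pos n)%:R ^+ 2) + 64 * C j ^+ 2 * M) => [|x x0].
  apply: addr_ge0; last by apply: mulr_ge0 => //; exact: mulr_ge0.
  by apply: mulr_ge0; rewrite ?addr_ge0 ?sqr_ge0.
rewrite ler_pdivlMr//.
have [xn|nx] := leP x (pos n)%:R.
  have := hL1 x; rewrite x0 xn => /(_ isT); rewrite -sqr_le_norm ?(ltW L10)// => h1.
  apply: (@le_trans _ _ (L1 ^+ 2 * (1 + (pos n)%:R ^+ 2))).
    apply: ler_pM; rewrite ?sqr_ge0 ?(ltW (one x))// /oneDsqr lerD2l.
    by rewrite ler_sqr// nnegrE.
  by rewrite lerDl; apply: mulr_ge0 => //; exact: mulr_ge0.
have [k xk] := pos_cover x0; case/andP: (xk) => kx xk1.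
have nk : (n <= k)%N.
  rewrite leqNgt; apply/negP => kn.
  have : (pos k.+1 <= pos n)%N.
    exact: pos_homo.
  by rewrite -(ler_nat R) => /(le_trans xk1); rewrite leNgt nx.
have [_ /(_ x xk) grow] := block_energy_decay (stk k nk).
have [|/stage_startP[p0 Np _ _]] := stage_started (pos k).
  by move=> s0; have := stk k nk; rewrite s0.
have p1 : 1 <= (pos k)%:R :> R by rewrite ler1n.
have x2 : x <= 2 * (pos k)%:R.
  apply: le_trans xk1 _; rewrite posS natrD.
  have : (block_length (stage (pos k)))%:R <= (pos k)%:R :> R by rewrite ler_nat.
  by lra.
have := decay k nk; rewrite /e /energy /=.
move: grow; set p := `|zsol1 coefs j x| + _.
set q := `|zsol1 coefs j _| + _ => pq dk.
have ux : `|usol coefs j x| <= C j * p.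
  have [aC bC] := ab_le j x0.
  rewrite usolE (le_trans (ler_normD _ _))// !normrM /p mulrDr.
  by rewrite lerD// mulrC ler_wpM2r.
have p0' : 0 <= p by rewrite addr_ge0.
have q0' : 0 <= q by rewrite addr_ge0.
have u2 : usol coefs j x ^+ 2 <= C j ^+ 2 * (4 * q ^+ 2).
  apply: (@le_trans _ _ ((C j * p) ^+ 2)).
    by rewrite sqr_le_norm// mulr_ge0.
  rewrite exprMn ler_wpM2l//.
  have -> : 4 * q ^+ 2 = (2 * q) ^+ 2 by ring.
  by rewrite ler_sqr ?nnegrE// mulr_ge0.
have q2 : q ^+ 2 <= 2 * (zsol1 coefs j (pos k)%:R ^+ 2 + zsol2 coefs j (pos k)%:R ^+ 2).
  rewrite -(real_normK (num_real (zsol1 _ _ _))) -(real_normK (num_real (zsol2 _ _ _))) /q.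
  move: `|zsol1 _ _ _| `|zsol2 _ _ _| => r s; have := sqr_ge0 (r - s); nra.
have one8 : oneDsqr x <= 8 * (pos k)%:R ^+ 2.
  rewrite /oneDsqr; move: x2 p1 x0; move: (pos k)%:R => y; nra.
apply: (@le_trans _ _ (C j ^+ 2 * (4 * q ^+ 2) * (8 * (pos k)%:R ^+ 2))).
  by apply: ler_pM; rewrite ?sqr_ge0 ?(ltW (one x)).
apply: (@le_trans _ _ (64 * C j ^+ 2 * M)); last first.
  by rewrite lerDr; apply: mulr_ge0; rewrite ?addr_ge0 ?sqr_ge0.
rewrite (_ : C j ^+ 2 * _ * _ = 32 * C j ^+ 2 * ((pos k)%:R ^+ 2 * q ^+ 2)); last by ring.
rewrite (_ : 64 * C j ^+ 2 * M = 32 * C j ^+ 2 * (2 * M)); last by ring.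
rewrite ler_wpM2l ?mulr_ge0//.
apply: le_trans (ler_wpM2l (sqr_ge0 _) q2) _.
by move: dk; set s := zsol1 _ _ _ ^+ 2 + _; lra.
Qed.

Lemma exists_decaying_potential : exists V : R -> R,
  [/\ smooth V, forall x, 0 < x -> `|V x| <= h x / (1 + x) &
    forall j, exists z1 z2 : R -> R,
    [/\ state_equation (a j) (b j) V (W j) z1 z2, z1 0 = (z0 j).1,
        z2 0 = (z0 j).2 & exists2 L, 0 <= L & forall x, 0 <= x ->
        (z1 x * a j x + z2 x * b j x) ^+ 2 <= L * (oneDsqr x)^-1]].
Proof.
exists (V coefs); split; [exact: smooth_potential|exact: potential_le|] => j.
exists (zsol1 coefs j), (zsol2 coefs j); split.
- exact: zsol_state_equation.
- by rewrite /zsol1 int00 addr0.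
- by rewrite /zsol2 int00 addr0.
have [L L0 hL] := usol_decay j.
by exists L => // x x0; rewrite -usolE; exact: hL.
Qed.

End recursion.

End control.

(** * Proof of the theorem *)

Lemma integrable_oneDsqrV (R : realType) :
  (@lebesgue_measure R).-integrable `]0, +oo[ (EFin \o (fun x : R => (oneDsqr x)^-1)).
Proof.
have i0 : (@lebesgue_measure R).-integrable `[0, +oo[ (EFin \o (fun x : R => (oneDsqr x)^-1)).
  apply/integrableP; split.
    apply/measurable_EFinP; apply: measurable_funTS.
    by apply: continuous_measurable_fun; exact: continuous_oneDsqrV.
  under eq_integral => x _.
    rewrite /= ger0_norm; last by rewrite invr_ge0 (le_trans _ (oneDsqr_ge1 x)).
    over.
  by rewrite integral0y_oneDsqr ltry.
by apply: integrableS i0 => //; apply: subset_itvr; rewrite bnd_simp.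
Qed.

Section perturbed_solution.
Context {R : realType}.
Notation mu := (@lebesgue_measure R).
Variables (V0 : R -> R) (E kappa : R) (a b a' b' : R -> R) (W : R).
Hypothesis fb : floquet_basis V0 E kappa a b a' b' W.
Variables (V z1 z2 : R -> R).
Hypothesis sin_kappa : sin kappa != 0.
Hypothesis cV : continuous V.
Hypothesis zE : state_equation a b V W z1 z2.

Let u x := z1 x * a x + z2 x * b x.
Let v x := z1 x * a' x + z2 x * b' x.

Let W0 : W != 0. Proof. by case: fb => _ _ _ _ []. Qed.

Lemma state_primitive :
  is_primitive `[0, +oo[ (fun t => - (V t * b t / W) * u t) z1 /\
  is_primitive `[0, +oo[ (fun t => V t * a t / W * u t) z2.
Proof.
have [ca cb _ _] := floquet_continuous fb.
have [c1 c2] := state_continuous_integrands ca cb cV zE.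
split=> s t; rewrite /= !in_itv/= !andbT => s0 t0 st; split;
  try exact: continuous_integrable_itv.
  exact: (stateB ca cb cV zE s0 st).1.
exact: (stateB ca cb cV zE s0 st).2.
Qed.

(** Since z1' a + z2' b = 0, the derivative of u is v; and z1' a' + z2' b' = V u (a b' - a' b) / W =
    V u supplies the new term of the equation. *)
Lemma perturbed_pair :
  schrodinger_pair (fun x => V x + V0 x) E `[0, +oo[ u v.
Proof.
have [p1 p2] := state_primitive.
have iI : is_interval (`[0, +oo[%classic : set R) by exact: interval_is_interval.
case: fb => [[ha ha'] [hb hb'] _ _ [_ Wx]].
have sub f F : is_primitive setT f F -> is_primitive (`[0, +oo[ : set R) f F.
  exact: is_primitiveS.
split.
  apply: eq_is_primitive (is_primitiveD (is_primitiveM iI p1 (sub _ _ ha))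
    (is_primitiveM iI p2 (sub _ _ hb))) => // x _.
  by rewrite /v; ring.
apply: eq_is_primitive (is_primitiveD (is_primitiveM iI p1 (sub _ _ ha'))
    (is_primitiveM iI p2 (sub _ _ hb'))) => // x _.
have -> : (V x + V0 x - E) * u x = V x * u x * ((a x * b' x - a' x * b x) / W) +
    (V0 x - E) * u x by rewrite Wx mulfV//; ring.
rewrite /u; ring.
Qed.

(** If u vanished on the half-line, z would be constant on [0, 1], and u(0) = u(1) = 0 would make
    z(0) orthogonal to (a(0), b(0)) and to its rotation by kappa. As sin(kappa) is nonzero, z(0) =
    0, against the initial data. *)
Lemma perturbed_nontrivial : u 0 != 0 \/ v 0 != 0 ->
  exists2 x, 0 <= x & u x != 0.
Proof.
move=> uv0; apply: contrapT => h.
have u0 x : 0 <= x -> u x = 0.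
  by move=> x0; apply: contrapT => /eqP ux; apply: h; exists x.
have [p1 p2] := state_primitive.
have I0 : (`[0, +oo[%classic : set R) 0 by rewrite /= in_itv/= lexx.
have I1 : (`[0, +oo[%classic : set R) 1 by rewrite /= in_itv/= ler01.
have int_u0 (f : R -> R) : \int[mu]_(t in `[0, 1]) (f t * u t) = 0.
  rewrite (_ : Rintegral _ _ _ = \int[mu]_(t in `[0, 1]) 0); last first.
    by apply: eq_Rintegral => t; rewrite inE/= in_itv/= => /andP[t0 _]; rewrite u0// mulr0.
  by rewrite Rintegral_cst// mul0r.
have [_ /eqP] := p1 0 1 I0 I1 ler01; rewrite int_u0 subr_eq0 => /eqP z11.
have [_ /eqP] := p2 0 1 I0 I1 ler01; rewrite int_u0 subr_eq0 => /eqP z21.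
have e0 := u0 0 (lexx 0); have e1 := u0 1 ler01.
have [ra rb] := floquet_rotation fb 1 0.
rewrite add0r mulr1 in ra rb.
move: e0 e1; rewrite /u z11 z21 ra rb => e0 e1.
have {}e1 : z2 0 * a 0 - z1 0 * b 0 = 0.
  have : sin kappa * (z2 0 * a 0 - z1 0 * b 0) = 0.
    rewrite (_ : _ * _ = z1 0 * (cos kappa * a 0 - sin kappa * b 0) +
        z2 0 * (sin kappa * a 0 + cos kappa * b 0) -
        cos kappa * (z1 0 * a 0 + z2 0 * b 0)); last by ring.
    by rewrite e0 e1 mulr0 subrr.
  by move=> /eqP; rewrite mulf_eq0 (negbTE sin_kappa)/= => /eqP.
have z10 : z1 0 = 0.
  have : (a 0 ^+ 2 + b 0 ^+ 2) * z1 0 = 0.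
    rewrite (_ : _ * _ = a 0 * (z1 0 * a 0 + z2 0 * b 0) - b 0 * (z2 0 * a 0 - z1 0 * b 0)).
      by rewrite e0 e1 !mulr0 subrr.
    by ring.
  by move=> /eqP; rewrite mulf_eq0 gt_eqF ?(floquet_neq0 fb)//= => /eqP.
have z20 : z2 0 = 0.
  have : (a 0 ^+ 2 + b 0 ^+ 2) * z2 0 = 0.
    rewrite (_ : _ * _ = b 0 * (z1 0 * a 0 + z2 0 * b 0) + a 0 * (z2 0 * a 0 - z1 0 * b 0)).
      by rewrite e0 e1 !mulr0 addr0.
    by ring.
  by move=> /eqP; rewrite mulf_eq0 gt_eqF ?(floquet_neq0 fb)//= => /eqP.
by case: uv0; rewrite /u /v z10 z20 !mul0r addr0 eqxx.
Qed.

Lemma perturbed_square_integrable L : 0 <= L ->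
  (forall x, 0 <= x -> u x ^+ 2 <= L * (oneDsqr x)^-1) ->
  square_integrable `]0, +oo[ u.
Proof.
move=> L0 uL.
have [ca cb _ _] := floquet_continuous fb.
have [cz1 cz2 _ _] := zE.
have cu : continuous (fun x => u x ^+ 2).
  move=> x; apply: (@cvg_comp _ _ _ _ (fun x : R => x ^+ 2)); last exact: exprn_continuous.
  by apply: cvgD; apply: cvgM; [exact: cz1|exact: ca|exact: cz2|exact: cb].
have iL : mu.-integrable `]0, +oo[ (EFin \o (fun x => L * (oneDsqr x)^-1)).
  apply: integrableZl_EFin => //.
  exact: integrable_oneDsqrV.
rewrite /square_integrable.
apply: le_integrable iL => //.
  by apply/measurable_EFinP; apply: measurable_funTS; exact: continuous_measurable_fun.
move=> x; rewrite /= in_itv/= andbT => x0.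
rewrite lee_fin !ger0_norm ?sqr_ge0//; first by apply: uL; exact: ltW.
by rewrite mulr_ge0// invr_ge0 (le_trans _ (oneDsqr_ge1 x)).
Qed.

End perturbed_solution.

Theorem theorem2p4 (R : realType) (V0 : R -> R)
    (V0_loc : locally_integrable setT V0)
    (V0_periodic : forall x : R, V0 (x + 1) = V0 x)
    (k : R -> R) (k_quasi : quasimomentum V0 k)
    (E : nat -> R) (E_bands : forall j : nat, open_bands V0 (E j))
    (k_distinct : forall i j : nat, i <> j -> k (E i) <> k (E j))
    (k_nonresonant : forall i j : nat, k (E i) + k (E j) <> pi)
    (h : R -> R) (h_pos : forall x : R, 0 < x -> 0 < h x)
    (h_infty : h x @[x --> +oo] --> +oo)
    (theta : nat -> R) (theta_range : forall j : nat, 0 <= theta j <= pi) :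
  exists V : R -> R,
    [/\ smooth_half_line V,
        forall x : R, 0 < x -> `|V x| <= h x / (1 + x) &
        forall j : nat, exists u u' : R -> R,
          [/\ schrodinger_pair (fun x => V x + V0 x) (E j) `[0, +oo[ u u',
              exists2 x : R, 0 <= x & u x != 0,
              square_integrable `]0, +oo[ u &
              boundary_condition (theta j) u u']].
Proof.
have [a /choice[b /choice[a' /choice[b' /choice[W fb]]]]] :=
  choice (fun j => exists_floquet_basis k_quasi (E_bands j)).
have [C hC] := choice (fun j => floquet_bounded (fb j)).
have [eta heta] := choice (fun j => exists_resonant_bump (fb j)).
(* Cramer's rule for u(0) = cos(theta) and u'(0) = sin(theta), data that include the Dirichlet
   case. *)
pose z0 j := ((cos (theta j) * b' j 0 - sin (theta j) * b j 0) / W j,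
              (sin (theta j) * a j 0 - cos (theta j) * a' j 0) / W j).
have kr j : 0 < k (E j) < pi by have [] := k_quasi _ (E_bands j).
have es i : smooth (eta i) by case: (heta i).
have e01 i x : 0 <= eta i x <= 1 by case: (heta i).
have eout i x : ~~ (0 < x < 1) -> eta i x = 0 by case: (heta i) => _ _ /(_ x).
have eres i : 0 < resX (eta i) (a i) (b i) ^+ 2 + resY (eta i) (a i) (b i) ^+ 2.
  by case: (heta i).
have [V [sV Vh hV]] := exists_decaying_potential fb kr k_distinct k_nonresonant
  (fun j => (hC j).1) (fun j => (hC j).2) es e01 eout eres z0 h_pos h_infty.
exists V; split => //; first exact: smooth_smooth_half_line.
move=> j; have [z1 [z2 [zE z10 z20 [L L0 uL]]]] := hV j.
have cV : continuous V := @smooth_continuous _ _ 0 sV.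
have sk : sin (k (E j)) != 0 by rewrite gt_eqF// sin_gt0_pi.
have [_ _ _ _ [W0 /(_ 0) W00]] := fb j.
exists (fun x => z1 x * a j x + z2 x * b j x), (fun x => z1 x * a' j x + z2 x * b' j x).
have u0 : z1 0 * a j 0 + z2 0 * b j 0 = cos (theta j).
  rewrite z10 z20 /z0/= (_ : _ + _ = cos (theta j) *
    (a j 0 * b' j 0 - a' j 0 * b j 0) / W j); last by ring.
  by rewrite W00 mulfK.
have v0 : z1 0 * a' j 0 + z2 0 * b' j 0 = sin (theta j).
  rewrite z10 z20 /z0/= (_ : _ + _ = sin (theta j) *
    (a j 0 * b' j 0 - a' j 0 * b j 0) / W j); last by ring.
  by rewrite W00 mulfK.
split.
- exact: (perturbed_pair (fb j) cV zE).
- apply: (perturbed_nontrivial (fb j) sk cV zE); rewrite u0 v0.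
  have [c0|] := eqVneq (cos (theta j)) 0; last by left.
  right; apply: contra_eqN (cos2Dsin2 (theta j)) => /eqP s0.
  by rewrite c0 s0 expr0n addr0 eq_sym oner_eq0.
- exact: (perturbed_square_integrable (fb j) zE L0 uL).
rewrite /boundary_condition u0 v0; case: eqVneq => [->|tpi]; first exact: cos_pihalf.
(* On [0, pi] the cosine is injective, so it vanishes only at pi/2. *)
split => //; apply: contra_neq tpi => c0.
have pi0 : 0 < pi :> R := pi_gt0 R.
by apply: cos_inj; rewrite ?in_itv//= ?cos_pihalf//; apply/andP; split; lra.
Qed.
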